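(* Let $N\ge 2$ and $k\ge 1$ be integers, and let $$q_{\mathbf N}(z)=z\exp\big(G_{\mathbf N}(z)/F_{\mathbf N}(z)\big),\qquad F_{\mathbf N}(z)=\sum_{m=0}^\infty \frac{(Nm)!^k}{m!^{kN}}z^m,\qquad G_{\mathbf N}(z)=\sum_{m=1}^\infty kN\,(H_{Nm}-H_m)\frac{(Nm)!^k}{m!^{kN}}z^m .$$ Let $$\Omega_N:=\prod_{p\le N}p^{\min\{2+\omega(p,N),\,v_p(H_N-1)\}},$$ the product being over all primes $p\le N$, where $\omega(p,N)=1$ if $p$ is a Wolstenholme prime or $N\equiv\pm1 \bmod p$, and $\omega(p,N)=0$ otherwise. Then $$\big(z^{-1}q_{\mathbf N}(z)\big)^{\frac{1}{\Omega_N N!^k kN}}\in\mathbb Z[[z]].$$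
   Context: $H_n=\sum_{i=1}^n \frac1i$ is the $n$-th harmonic number. $v_p$ is the $p$-adic valuation on $\mathbb Q$ (so $v_p(H_N-1)$ may be negative, and $\Omega_N$ is a positive rational number). $\mathbf N=(N,\dots,N)$ is the vector with $k$ occurrences of $N$. A prime $p$ is a Wolstenholme prime if $v_p(H_{p-1})\ge 3$. For a power series $q(z)=\exp(g(z))$ with $g(z)\in z\mathbb Q[[z]]$ and a rational number $\alpha$, $q(z)^\alpha$ denotes $\exp(\alpha g(z))$. *)

(* Defs.v *)
(* Plain MathComp; formal power series over Q are coefficient functions
   nat -> rat, compared pointwise with =1. *)
From mathcomp Require Import all_boot all_order all_algebra.

Set Implicit Arguments.
Unset Strict Implicit.
Unset Printing Implicit Defensive.

Import Order.TTheory GRing.Theory Num.Theory.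
Local Open Scope ring_scope.

Definition ps := nat -> rat.

Definition ps_one : ps := fun n => (n == 0%N)%:R.

Definition ps_scale (c : rat) (a : ps) : ps := fun n => c * a n.

Definition ps_mul (a b : ps) : ps :=
  fun n => \sum_(i < n.+1) a i * b (n - i)%N.

Definition ps_pow (a : ps) (k : nat) : ps := iter k (ps_mul a) ps_one.

(* z * a(z) *)
Definition ps_mulz (a : ps) : ps := fun n => if n is m.+1 then a m else 0.

(* z^-1 * a(z), for a series a with zero constant term *)
Definition ps_divz (a : ps) : ps := fun n => a n.+1.

(* exp(g) for g with zero constant term: g^j / j! then contributes to the
   coefficient of z^n only for j <= n. *)
Definition ps_exp (g : ps) : ps :=
  fun n => \sum_(j < n.+1) ps_pow g j n / j`!%:R.

(* The first n coefficients of b / a, by long division. *)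
Fixpoint ps_div_prefix (b a : ps) (n : nat) : seq rat :=
  if n is m.+1 then
    let c := ps_div_prefix b a m in
    rcons c ((b m - \sum_(i < m) c`_i * a (m - i)%N) / a 0%N)
  else [::].

(* b / a for a with nonzero constant term; see ps_divK. *)
Definition ps_div (b a : ps) : ps := fun n => (ps_div_prefix b a n.+1)`_n.

(* b = a^alpha: a = exp(g) and b = exp(alpha g) for some g in z Q[[z]].
   Such a g, hence b, is unique by ps_exp_inj. *)
Definition ps_is_rpow (a : ps) (alpha : rat) (b : ps) : Prop :=
  exists2 g : ps, g 0%N = 0 & a =1 ps_exp g /\ b =1 ps_exp (ps_scale alpha g).

Definition ps_integral (a : ps) : Prop := forall n : nat, a n \is a Num.int.

Definition harmonic (n : nat) : rat := \sum_(1 <= i < n.+1) i%:R^-1.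

(* The p-adic valuation of a nonzero rational, p prime; the value at x = 0 is
   the junk value 0. *)
Definition vp (p : nat) (x : rat) : int :=
  (logn p `|numq x|%N)%:Z - (logn p `|denq x|%N)%:Z.

Definition wolstenholme (p : nat) : bool :=
  prime p && (3%:Z <= vp p (harmonic p.-1)).

Definition omega (p N : nat) : nat :=
  if [|| wolstenholme p, (N%:Z == 1 %[mod p%:Z])%Z
       | (N%:Z == - 1 %[mod p%:Z])%Z] then 1%N else 0%N.

Definition Omega (N : nat) : rat :=
  \prod_(p < N.+1 | prime p)
    p%:R ^ Num.min (2 + omega p N)%N%:Z (vp p (harmonic N - 1)).

Definition F_series (N k : nat) : ps :=
  fun m => ((N * m)`! ^ k)%N%:R / (m`! ^ (k * N))%N%:R.

(* The term m = 0 vanishes. *)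
Definition G_series (N k : nat) : ps :=
  fun m => (k * N)%N%:R * (harmonic (N * m) - harmonic m) * F_series N k m.

Definition q_map (N k : nat) : ps :=
  ps_mulz (ps_exp (ps_div (G_series N k) (F_series N k))).

Lemma size_ps_div_prefix b a n : size (ps_div_prefix b a n) = n.
Proof. by elim: n => //= n IH; rewrite size_rcons IH. Qed.

Lemma nth_ps_div_prefix b a n i :
  (i < n)%N -> (ps_div_prefix b a n)`_i = ps_div b a i.
Proof.
elim: n => // n IH; rewrite ltnS leq_eqVlt => /predU1P[->//|lt_in].
by rewrite /= nth_rcons size_ps_div_prefix lt_in IH.
Qed.

Lemma ps_divK b a : a 0%N != 0 -> ps_mul (ps_div b a) a =1 b.
Proof.
move=> a0 n; rewrite /ps_mul big_ord_recr /= subnn.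
rewrite {2}/ps_div /= nth_rcons size_ps_div_prefix ltnn eqxx divfK //.
rewrite addrC -[RHS](subrK (\sum_(i < n) ps_div b a i * a (n - i)%N)).
congr (_ - _ + _); apply: eq_bigr => i _.
by rewrite nth_ps_div_prefix.
Qed.

Lemma ps_pow_eq_below (g h : ps) n :
  (forall i, (i < n)%N -> g i = h i) ->
  forall k m, (m < n)%N -> ps_pow g k m = ps_pow h k m.
Proof.
move=> gh; elim=> // k IH m lt_mn; rewrite /ps_pow /= /ps_mul.
apply: eq_bigr => i _; rewrite gh; last by exact: leq_ltn_trans (leq_ord i) _.
by congr (_ * _); apply: IH; exact: leq_ltn_trans (leq_subr _ _) _.
Qed.

Lemma ps_powS0 (g : ps) k : g 0%N = 0 -> ps_pow g k.+1 0%N = 0.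
Proof. by move=> g0; rewrite /ps_pow /= /ps_mul big_ord1 g0 mul0r. Qed.

Lemma ps_pow1 (g : ps) : ps_pow g 1 =1 g.
Proof.
move=> n; rewrite /ps_pow /= /ps_mul big_ord_recr /= subnn mulr1 big1 ?add0r //.
by move=> i _; rewrite /ps_one subn_eq0 leqNgt ltn_ord mulr0.
Qed.

Lemma ps_expS (g : ps) n :
  ps_exp g n.+1 = g n.+1 + \sum_(i < n) ps_pow g i.+2 n.+1 / (i.+2)`!%:R.
Proof.
rewrite /ps_exp big_ord_recl big_ord_recl.
rewrite {1}/ps_pow {1}/ps_one /= mul0r add0r.
by congr (_ + _); rewrite -[RHS](ps_pow1 g n.+1) divr1.
Qed.

Lemma ps_exp_inj (g h : ps) :
  g 0%N = 0 -> h 0%N = 0 -> ps_exp g =1 ps_exp h -> g =1 h.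
Proof.
move=> g0 h0 eq_exp n; elim/ltn_ind: n => -[|n] IH; first by rewrite g0 h0.
have := eq_exp n.+1; rewrite !ps_expS; set S := bigop _ _ _.
suff -> : S = \sum_(i < n) ps_pow h i.+2 n.+1 / (i.+2)`!%:R by move/addIr.
apply: eq_bigr => i _; congr (_ / _).
change (ps_mul g (ps_pow g i.+1) n.+1 = ps_mul h (ps_pow h i.+1) n.+1).
apply: eq_bigr => j _; have [->|j0] := eqVneq (j : nat) 0%N.
  by rewrite g0 h0 !mul0r.
have [jn|lt_jn] := leqP n.+1 j.
  have -> : (n.+1 - j = 0)%N by apply/eqP; rewrite subn_eq0.
  by rewrite !ps_powS0 ?mulr0.
rewrite IH //; congr (_ * _).
by apply: (@ps_pow_eq_below g h n.+1) => //; rewrite ltn_subrL lt0n j0.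
Qed.

Lemma ps_is_rpow_uniq (a : ps) (alpha : rat) (b c : ps) :
  ps_is_rpow a alpha b -> ps_is_rpow a alpha c -> b =1 c.
Proof.
case=> g g0 [ag bg] [h h0 [ah ch]] n; rewrite bg ch.
have gh : g =1 h by apply: ps_exp_inj => // m; rewrite -ag -ah.
apply: eq_bigr => j _; congr (_ / _).
by apply: (@ps_pow_eq_below _ _ n.+1) => // i _; rewrite /ps_scale gh.
Qed.

(* Main.v *)
(* A rational is an integer iff it is integral at every prime p.  By the
   Dieudonne-Dwork lemma, exp(g) is p-integral as soon as g(z^p) - p g(z) has
   coefficients divisible by p.  For g proportional to G/F, multiplying by
   F(z) F(z^p) turns this into a divisibility of the sums
     sum_j (H~(j) - p H~(a + p(K-j))) B(a + p(K-j)) B(j),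
   where B(m) is the m-th coefficient of F and H~(m) = H_{Nm} - H_m.
   Antisymmetry in j <-> K-j and Abel summation over p-adic blocks reduce it to
   Dwork's congruences for B and to two facts about v = v_p(Omega_N):
   - B(m) / N!^k (H~(m) - H~(p [m/p])) is divisible by p^v: the first coefficient
     is H_N - 1 itself, and all later ones gain at least [N/p] - 1 factors p from
     the factorials;
   - p H~(pj) - H~(j) is divisible by p^(v+1), by a Wolstenholme type congruence:
     the block sums s_i = sum_{0<l<p} 1/(pi+l) satisfy s_i = (2i+1) s_0 mod p^3,
     so that the difference is p s_0 j^2 (N^2-1) mod p^4.
   When v > 0, H_[N/p] is divisible by p, which forces [N/p] > v except for small
   primes; these are settled by a finite computation. *)
Require Import Defs.
From HB Require Import structures.
From mathcomp Require Import all_boot all_order all_algebra.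
From mathcomp Require Import ring zify.
Import Order.TTheory GRing.Theory Num.Theory.
Local Open Scope ring_scope.

Set Implicit Arguments.
Unset Strict Implicit.
Unset Printing Implicit Defensive.

(** * Rationals integral at a prime *)

(* Coprimality, rather than non-divisibility, makes this a subring for every p,
   prime or not. *)
Definition pint (p : nat) : {pred rat} := fun x => coprime p `|denq x|.

Lemma pintE p x : (x \in pint p) = coprime p `|denq x|. Proof. by []. Qed.

Lemma pint_den p x (d : nat) :
  coprime p d -> x * d%:R \is a Num.int -> x \in pint p.
Proof.
move=> pd /intrP[m xd]; rewrite pintE.
have e : numq x * d%:Z = m * denq x.
  apply: (@intr_inj rat).
  by rewrite !rmorphM /= -xd numqE; set y := (_%:~R); rewrite mulrAC.
apply: coprime_dvdr pd; rewrite -(@Gauss_dvdr _ `|numq x|); last first.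
  by rewrite coprime_sym coprime_num_den.
by rewrite -(absz_nat d) -abszM e abszM dvdn_mull.
Qed.

Lemma pint_denP p x : x \in pint p ->
  exists d : nat, coprime p d /\ x * d%:R \is a Num.int.
Proof.
move=> px; exists `|denq x|%N; split=> //.
by rewrite natr_absz normr_denq -numqE.
Qed.

(** Turns a goal into a field identity with an element already known to be integral; [ring] or
    [field] then closes it. *)
Lemma eq_pint p x y : x = y -> x \in pint p -> y \in pint p.
Proof. by move=> ->. Qed.

Lemma pint_subring p : subring_closed (pint p).
Proof.
split.
- by rewrite pintE coprimen1.
- move=> x y /pint_denP[d [pd xd]] /pint_denP[e [pe ye]].
  apply: (@pint_den _ _ (d * e)); first by rewrite coprimeMr pd.
  have -> : (x - y) * (d * e)%:R = x * d%:R * e%:R - y * e%:R * d%:R.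
    by rewrite natrM; ring.
  by rewrite rpredB // rpredM // natr_int.
- move=> x y /pint_denP[d [pd xd]] /pint_denP[e [pe ye]].
  apply: (@pint_den _ _ (d * e)); first by rewrite coprimeMr pd.
  have -> : (x * y) * (d * e)%:R = x * d%:R * (y * e%:R).
    by rewrite natrM; ring.
  by rewrite rpredM.
Qed.

HB.instance Definition _ (p : nat) :=
  GRing.isSubringClosed.Build rat (pint p) (pint_subring p).

Lemma pint_int p x : x \is a Num.int -> x \in pint p.
Proof. by move=> xi; apply: (@pint_den _ _ 1); rewrite ?coprimen1 ?mulr1. Qed.


Lemma pintV p d : coprime p d -> d%:R^-1 \in pint p.
Proof.
case: d => [|d] pd; first by rewrite invr0 rpred0.
by apply: (pint_den pd); rewrite mulVf ?pnatr_eq0.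
Qed.

Lemma pint_exprz p q (e : int) : coprime p q -> q%:R ^ e \in pint p.
Proof.
move=> pq; case: e => e; first by rewrite -exprnP rpredX ?rpred_nat.
by rewrite NegzE -exprnN -exprVn rpredX ?pintV.
Qed.

Lemma int_pint x : (forall p, prime p -> x \in pint p) -> x \is a Num.int.
Proof.
move=> h; have d0 : (0 < `|denq x|)%N by rewrite absz_gt0 denq_neq0.
case: (ltnP 1 `|denq x|) => d1.
  have := h _ (pdiv_prime d1); rewrite pintE prime_coprime ?pdiv_prime //.
  by rewrite pdiv_dvd.
have e : denq x = 1 by rewrite -absz_denq; congr Posz; apply/eqP;
  rewrite eqn_leq d1 d0.
by rewrite -(divq_num_den x) e divr1 intr_int.
Qed.

Lemma vp_pint p x (e : int) : prime p -> e <= vp p x -> x / p%:R ^ e \in pint p.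
Proof.
move=> pp; rewrite /vp.
(* At [x = 0] the junk value of [vp] is harmless, since the quotient is 0. *)
have [->|x0] := eqVneq x 0; first by rewrite mul0r rpred0.
have n0 : (0 < `|numq x|)%N by rewrite absz_gt0 numq_eq0.
have d0 : (0 < `|denq x|)%N by rewrite absz_gt0 denq_neq0.
have pu : p%:R != 0 :> rat by rewrite pnatr_eq0 -lt0n prime_gt0.
have [u pnu en] := pfactor_coprime pp n0.
have [d pnd ed] := pfactor_coprime pp d0.
set a := logn p _ in en *; set b := logn p _ in ed * => le_e.
have en' : (numq x)%:~R = (sgz (numq x))%:~R * u%:R * p%:R ^+ a :> rat.
  by rewrite {1}[numq x]intEsg rmorphM /= -pmulrn en natrM natrX mulrA.
have ed' : (denq x)%:~R = d%:R * p%:R ^+ b :> rat.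
  by rewrite -(absz_denq x) -pmulrn ed natrM natrX.
have -> : x / p%:R ^ e =
    (sgz (numq x))%:~R * u%:R / d%:R * p%:R ^ (a%:Z - b%:Z - e).
  rewrite -{1}(divq_num_den x) en' ed' !expfzDr // -!invr_expz -!exprnP.
  by rewrite invfM; ring.
apply: rpredM; first by rewrite rpredM ?pintV // rpredM // pint_int // intr_int.
have : 0 <= a%:Z - b%:Z - e by lia.
by case: (_ - e) => // m _; rewrite -exprnP rpredX ?rpred_nat.
Qed.

(** * Factorials and rising factorials at a prime *)

Definition pochn (b t : nat) : nat := (\prod_(l < t) (b + l.+1))%N.

Lemma pochnS b t : pochn b t.+1 = (pochn b t * (b + t).+1)%N.
Proof. by rewrite /pochn big_ord_recr /= addnS. Qed.

Lemma fact_pochn b t : (b + t)`! = (b`! * pochn b t)%N.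
Proof.
elim: t => [|t IH]; first by rewrite /pochn big_ord0 addn0 muln1.
by rewrite pochnS mulnA -IH addnS factS mulnC.
Qed.

(* The prime-to-p cofactor of (p M + v)!. *)
Definition pfree_fact (p v M : nat) : nat :=
  ((\prod_(i < M) \prod_(l < p.-1) (p * i + l.+1)) *
   \prod_(l < v) (p * M + l.+1))%N.

Lemma pfree_factS p M : (0 < p)%N ->
  pfree_fact p 0 M.+1 = pfree_fact p p.-1 M.
Proof. by move=> p0; rewrite /pfree_fact big_ord_recr /= big_ord0 muln1. Qed.

(** The factors p, 2p, ..., pM contribute p^M M!, and [pfree_fact] collects all the others. *)
Lemma fact_pfree_fact p M v : (0 < p)%N ->
  (p * M + v)`! = (p ^ M * M`! * pfree_fact p v M)%N.
Proof.
move=> p0; elim: M v => [|M IH] v.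
  by rewrite /pfree_fact big_ord0 muln0 fact_pochn fact0 !mul1n.
have {}IH : (p * M.+1)`! = (p ^ M.+1 * M.+1`! * pfree_fact p 0 M.+1)%N.
  rewrite pfree_factS // -[in LHS](prednK p0) mulnS prednK // addnC.
  rewrite -{2}(prednK p0) addnS factS IH expnS [M.+1`!]factS -addnS prednK //.
  by rewrite -{1}[p in (_ + p)%N]muln1 -mulnDr addn1; ring.
by rewrite fact_pochn IH /pfree_fact big_ord0 muln1 !mulnA.
Qed.

Lemma coprime_pfree_fact p v M : prime p -> (v < p)%N ->
  coprime p (pfree_fact p v M).
Proof.
move=> pp vp.
have h i l : (l.+1 < p)%N -> coprime p (p * i + l.+1).
  move=> lp; rewrite prime_coprime // dvdn_addr ?dvdn_mulr //.
  by apply/negP => /dvdn_leq; lia.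
rewrite coprimeMr; apply/andP; split.
  apply: (big_ind (coprime p)) => [|x y px py|i _];
    rewrite ?coprimen1 ?coprimeMr ?px //.
  apply: (big_ind (coprime p)) => [|x y px py|l _];
    rewrite ?coprimen1 ?coprimeMr ?px //.
  by apply: h; have := ltn_ord l; lia.
apply: (big_ind (coprime p)) => [|x y px py|l _];
  rewrite ?coprimen1 ?coprimeMr ?px //.
by apply: h; have := ltn_ord l; lia.
Qed.

(** With m = [(n+1)/p], [fact_pfree_fact] leaves p^(n-m) / m! up to a unit; n+1 >= 2m gives n-m >=
    m-1, and induction applies. *)
Lemma exp_fact_pint p n : prime p -> p%:R ^+ n / n.+1`!%:R \in pint p.
Proof.
move=> pp; have p0 := prime_gt0 pp; have p1 := prime_gt1 pp.
have pu : p%:R != 0 :> rat by rewrite pnatr_eq0 -lt0n.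
elim/ltn_ind: n => n IH.
have rp := ltn_pmod n.+1 p0.
rewrite (divn_eq n.+1 p) [(_ %/ _ * _)%N]mulnC fact_pfree_fact //.
set m := (n.+1 %/ p)%N; have := coprime_pfree_fact m pp rp.
move: (pfree_fact _ _ _) => d pd; rewrite !natrM natrX.
have le_mn : (m <= n)%N by rewrite -ltnS ltn_Pdiv.
have -> : p%:R ^+ n = p%:R ^+ m * p%:R ^+ (n - m) :> rat by rewrite -exprD subnKC.
have -> : p%:R ^+ m * p%:R ^+ (n - m) / (p%:R ^+ m * m`!%:R * d%:R)
   = p%:R ^+ (n - m) / m`!%:R / d%:R :> rat.
  by rewrite -[X in _ / X]mulrA -mulf_div divff ?expf_neq0 // mul1r invfM mulrA.
apply: rpredM; last exact: pintV.
have h : (m * p <= n.+1)%N by rewrite leq_trunc_div.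
case: m le_mn h => [|m] le_mn h; first by rewrite divr1 rpredX ?rpred_nat.
have -> : (n - m.+1 = m + (n - m.+1 - m))%N.
  have : (m.+1 * 2 <= m.+1 * p)%N by rewrite leq_mul2l p1 orbT.
  lia.
rewrite exprD mulrAC; apply: rpredM; first by apply: IH.
by rewrite rpredX ?rpred_nat.
Qed.

(** * The Dieudonne-Dwork criterion *)

Definition eq_below n (P Q : {poly rat}) := forall i, (i < n)%N -> P`_i = Q`_i.

Lemma eq_belowM n P P' Q Q' : eq_below n P P' -> eq_below n Q Q' ->
  eq_below n (P * Q) (P' * Q').
Proof.
move=> hP hQ i lt_in; rewrite !coefM; apply: eq_bigr => j _.
by have := ltn_ord j => ?; rewrite hP ?hQ //; lia.
Qed.

(* E = exp G modulo X^(n+1), characterised by E' = G' E so that sums, multiples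
   and the substitution X -> X^p of G are handled by differentiating. *)
Definition is_exp n (G E : {poly rat}) :=
  E`_0 = 1 /\ eq_below n E^`() (G^`() * E).

(** The coefficient of X^m in E' = G' E determines (m+1) times the next coefficient of E from the
    earlier ones. *)
Lemma is_exp_uniq n (G G' E E' : {poly rat}) :
  (forall i, (i <= n)%N -> G`_i = G'`_i) -> is_exp n G E -> is_exp n G' E' ->
  forall i, (i <= n)%N -> E`_i = E'`_i.
Proof.
move=> hG [E0 hE] [E'0 hE']; elim/ltn_ind=> -[_ _|m IH le_mn].
  by rewrite E0 E'0.
have := hE m le_mn; have := hE' m le_mn; rewrite !coef_deriv !coefM => e' e.
apply: (@mulfI _ m.+1%:R); rewrite ?pnatr_eq0 // !mulr_natl e e'.
apply: eq_bigr => i _; rewrite !coef_deriv hG ?IH //; have := ltn_ord i => ?; lia.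
Qed.

Lemma is_expM n F G D E :
  is_exp n F D -> is_exp n G E -> is_exp n (F + G) (D * E).
Proof.
move=> [D0 hD] [E0 hE]; split; first by rewrite coef0M D0 E0 mulr1.
move=> i lt_in; rewrite derivM derivD mulrDl !coefD.
rewrite (eq_belowM hD (fun _ _ => erefl) lt_in) (eq_belowM (fun _ _ =>
  erefl) hE lt_in).
by rewrite mulrA [D * _]mulrC !mulrA.
Qed.

Lemma is_expX n G E k : is_exp n G E -> is_exp n (G *+ k) (E ^+ k).
Proof.
move=> hE; elim: k => [|k IH]; last by rewrite mulrS exprS; exact: is_expM.
rewrite mulr0n expr0; split; first by rewrite coef1.
by move=> i _; rewrite deriv0 mul0r derivC.
Qed.

Lemma is_exp_compXn n p G E :
  (0 < p)%N -> is_exp n G E -> is_exp n (G \Po 'X^p) (E \Po 'X^p).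
Proof.
move=> p0 [E0 hE]; split; first by rewrite coef_comp_poly_Xn // dvdn0 div0n.
rewrite !deriv_comp mulrAC; apply: eq_belowM => // i lt_in.
rewrite -comp_polyM !coef_comp_poly_Xn //; case: ifP => // _.
by apply: hE; apply: leq_ltn_trans lt_in; exact: leq_div.
Qed.

Lemma coef_exp_lt (G : {poly rat}) j i : G`_0 = 0 -> (i < j)%N -> (G ^+ j)`_i = 0.
Proof.
move=> G0; elim: j i => // j IH i lt_ij; rewrite exprS coefM big1 // =>
  -[[|l] /= lt_l] _.
  by rewrite G0 mul0r.
by rewrite IH ?mulr0 //; lia.
Qed.

Lemma coef0X (P : {poly rat}) k : (P ^+ k)`_0 = P`_0 ^+ k.
Proof. by rewrite -!horner_coef0 horner_exp. Qed.

Definition exp_trunc n (G : {poly rat}) : {poly rat} :=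
  \sum_(j < n.+1) (j`!%:R^-1) *: G ^+ j.

(** Differentiating the partial sum loses its last power of [G], and G' G^n contributes nothing
    below X^n as [G] has zero constant term. *)
Lemma is_exp_trunc n (G : {poly rat}) : G`_0 = 0 -> is_exp n G (exp_trunc n G).
Proof.
move=> G0; split.
  rewrite /exp_trunc coef_sum big_ord_recl expr0 invr1 scale1r coef1 big1 ?addr0 //.
  by move=> i _; rewrite coefZ coef_exp_lt ?mulr0.
move=> i lt_in; rewrite /exp_trunc raddf_sum /= big_ord_recl expr0 derivZ derivC
  scaler0 add0r.
rewrite [X in _ * X]big_ord_recr mulrDr coefD -scalerAr coefZ /=.
rewrite [X in _ = _ + _ * X]coefM [X in _ = _ + _ * X]big1 ?mulr0 ?addr0;
  last first.
  by move=> j _; rewrite (coef_exp_lt G0) ?mulr0 //; lia.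
rewrite mulr_sumr !coef_sum; apply: eq_bigr => j _.
rewrite derivZ deriv_exp /= -scalerAr /bump /= add1n.
rewrite -scaler_nat scalerA factS natrM invfM mulrAC mulVf ?mul1r //.
by rewrite pnatr_eq0.
Qed.

Lemma ps_pow_poly (g : ps) n j i : (i <= n)%N ->
  ps_pow g j i = ((\poly_(i < n.+1) g i) ^+ j)`_i.
Proof.
elim: j i => [|j IH] i le_in; first by rewrite expr0 coef1.
rewrite exprS coefM /ps_pow /= /ps_mul; apply: eq_bigr => l _.
have ? := ltn_ord l; rewrite coef_poly; case: ltnP => [_|]; last lia.
by congr (_ * _); apply: IH; lia.
Qed.

Lemma ps_exp_poly (g : ps) n : ps_exp g n = (exp_trunc n (\poly_(i < n.+1) g i))`_n.
Proof.
rewrite /ps_exp /exp_trunc coef_sum; apply: eq_bigr => j _.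
by rewrite coefZ (ps_pow_poly _ _ (leqnn n)) mulrC.
Qed.

Lemma exprD_prime (R : comNzRingType) p (x y : R) : prime p ->
  (x + y) ^+ p =
  x ^+ p + y ^+ p +
  (\sum_(0 <= i < p.-1) ('C(p, i.+1) %/ p)%:R * (x ^+ (p - i.+1) * y ^+ i.+1)) *+ p.
Proof.
move=> pp; have p0 := prime_gt0 pp; rewrite exprDn.
rewrite -(big_mkord xpredT (fun i => (x ^+ (p - i) * y ^+ i) *+ 'C(p, i))).
case: p pp p0 => // p pp _ /=.
rewrite big_nat_recr //= big_nat_recl // subn0 subnn bin0 binn !mulr1n.
rewrite !expr0 mulr1 mul1r [RHS]addrAC; congr (_ + _ + _).
rewrite !big_mkord -sumrMnl; apply: eq_bigr => i _.
rewrite mulr_natl -mulrnA divnK //.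
by apply: prime_dvd_bin; rewrite // !ltnS ltn_ord.
Qed.

Lemma pintX_sub p x y : prime p -> x \in pint p -> y \in pint p ->
  ((x + y) ^+ p - x ^+ p - y ^+ p) / p%:R \in pint p.
Proof.
move=> pp px py; rewrite (exprD_prime x y pp) -[_ *+ p]mulr_natr.
set S := bigop _ _ _.
have -> : (x ^+ p + y ^+ p + S * p%:R - x ^+ p - y ^+ p) / p%:R = S.
  have p0 : p%:R != 0 :> rat by rewrite pnatr_eq0 -lt0n prime_gt0.
  by rewrite addrC addrA -[X in X / _](_ : S * p%:R = _) ?mulfK //; ring.
by apply: rpred_sum => i _; rewrite !rpredM ?rpredX ?rpred_nat.
Qed.

(** The Fermat quotient is additive up to integral terms, which gives the naturals by induction and
    then the integers. For x = m/d, d^p (x^p - x) = (m^p - m) - x (d^p - d). *)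
Lemma pint_fermat p x : prime p -> x \in pint p -> (x ^+ p - x) / p%:R \in pint p.
Proof.
move=> pp px; have p0 : p%:R != 0 :> rat by rewrite pnatr_eq0 -lt0n prime_gt0.
have fD a b : a \in pint p -> b \in pint p ->
    ((a + b) ^+ p - (a + b)) / p%:R
     - ((a ^+ p - a) / p%:R + (b ^+ p - b) / p%:R) \in pint p.
  by move=> pa pb; apply: eq_pint (pintX_sub pp pa pb); ring.
have fn n : (n%:R ^+ p - n%:R) / p%:R \in pint p.
  elim: n => [|n IH].
    by rewrite expr0n gtn_eqF ?prime_gt0 // subrr mul0r rpred0.
  have := fD n%:R 1 (rpred_nat _ _) (rpred1 _).
  rewrite natr1 => /(rpredD IH); rewrite expr1n subrr mul0r addr0 addrC.
  by rewrite subrK.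
have fi (m : int) : (m%:~R ^+ p - m%:~R) / p%:R \in pint p.
  case: m => n; first exact: fn.
  rewrite NegzE rmorphN /=.
  have := fD (- n.+1%:R) n.+1%:R; rewrite rpredN !rpred_nat => /(_ isT isT).
  rewrite addNr expr0n gtn_eqF ?prime_gt0 // subr0 mul0r sub0r rpredN.
  by move/rpredB => /(_ _ (fn n.+1)); rewrite addrK.
have [d [pd /intrP[m xd]]] := pint_denP px.
have d0 : d%:R != 0 :> rat.
  rewrite pnatr_eq0 -lt0n lt0n; apply: contraL pd => /eqP->.
  by rewrite /coprime gcdn0 gtn_eqF ?prime_gt1.
have -> : (x ^+ p - x) / p%:R =
   ((m%:~R ^+ p - m%:~R) / p%:R - x * ((d%:R ^+ p - d%:R) / p%:R)) * d%:R^-1 ^+ p.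
  rewrite -xd exprMn exprVn; field.
  by rewrite p0 expf_neq0.
apply: rpredM; last by apply/rpredX/pintV.
by apply: rpredB; [exact: fi | apply: rpredM px (fn d)].
Qed.

(** Horner induction: [exprD_prime] detaches the constant coefficient, on which Fermat's little
    theorem acts. *)
Lemma poly_frobenius p (P : {poly rat}) : prime p -> P \is a polyOver (pint p) ->
  p%:R^-1 *: (P ^+ p - (P \Po 'X^p)) \is a polyOver (pint p).
Proof.
move=> pp; have p0 := prime_gt0 pp.
have pu : p%:R != 0 :> rat by rewrite pnatr_eq0 -lt0n.
elim/poly_ind: P => [|P c IH] hP.
  by rewrite comp_poly0 expr0n gtn_eqF // subrr scaler0 rpred0.
have hP' : P \is a polyOver (pint p).
  apply/polyOverP => i; have /polyOverP/(_ i.+1) := hP.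
  by rewrite coefD coefMX coefC addr0.
have hc : c \in pint p.
  by have /polyOverP/(_ 0%N) := hP; rewrite coefD coefMX coefC add0r.
rewrite comp_polyD comp_polyM comp_polyX comp_polyC exprD_prime //.
set S := bigop _ _ _.
have -> : p%:R^-1 *: ((P * 'X) ^+ p + c%:P ^+ p + S *+ p - ((P \Po 'X^p) * 'X^p
  + c%:P))
  = (p%:R^-1 *: (P ^+ p - (P \Po 'X^p))) * 'X^p + ((c ^+ p - c) / p%:R)%:P + S.
  have e : S = (p%:R^-1)%:P * (S *+ p).
    by rewrite mul_polyC -scaler_nat scalerA mulVf ?scale1r.
  rewrite [X in _ = _ + X]e -!mul_polyC exprMn !rmorphM rmorphB rmorphXn /=.
  move: (S *+ p) => T; ring.
rewrite !rpredD ?rpredM ?IH ?polyOverXn ?polyOverC ?pint_fermat //.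
have hPX : P * 'X \is a polyOver (pint p) by rewrite rpredM ?polyOverX.
apply: rpred_sum => i _; apply: rpredM; first exact: rpred_nat.
by rewrite rpredM // rpredX // polyOverC.
Qed.


Section DieudonneDwork.

Variables (p : nat) (g : ps).
Hypotheses (pp : prime p) (g0 : g 0%N = 0).
Hypothesis hg : forall n,
  ((if (p %| n)%N then g (n %/ p)%N else 0) - p%:R * g n) / p%:R \in pint p.

Let pu : p%:R != 0 :> rat. Proof. by rewrite pnatr_eq0 -lt0n prime_gt0. Qed.

(** Only powers with j >= 1 reach a positive index, and p^j / j! is p times an integral number by
    [exp_fact_pint]. *)
Lemma exp_trunc_scale_pint n (W : {poly rat}) : (forall i, W`_i \in pint p) ->
  W`_0 = 0 ->
  forall i, (0 < i)%N -> (exp_trunc n (p%:R *: W))`_i / p%:R \in pint p.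
Proof.
move=> hW W0 i i0; rewrite /exp_trunc coef_sum mulr_suml.
have hWX j : W ^+ j \is a polyOver (pint p) by rewrite rpredX //; apply/polyOverP.
apply: rpred_sum => -[[|j] /= _] _.
  by rewrite expr0 coefZ coef1 gtn_eqF // mulr0 mul0r rpred0.
rewrite coefZ exprZn coefZ mulrA mulrAC; apply: rpredM; last first.
  exact/polyOverP.
by rewrite exprSr mulrA mulfK // mulrC exp_fact_pint.
Qed.

(** With g(z^p) - p g(z) = -p W(z), the series E = exp(g) satisfies E^p = E(z^p) V, where V = exp(p
    W) is congruent to 1 mod p. The coefficients of E come out integral one by one: the next one
    enters E^p with the factor p and E(z^p) not at all, and the truncation T before it has T^p
    congruent to T(z^p) mod p. *)
Lemma dieudonne_dwork n : ps_exp g n \in pint p.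
Proof.
rewrite ps_exp_poly; set G := \poly_(_ < _) _.
have p0 := prime_gt0 pp.
have G0 : G`_0 = 0 by rewrite coef_poly.
have GX0 : (G \Po 'X^p)`_0 = 0 by rewrite coef_comp_poly_Xn // dvdn0 div0n.
pose W : {poly rat} :=
  \poly_(i < n.+1) ((p%:R * G`_i - (G \Po 'X^p)`_i) / p%:R).
have W0 : W`_0 = 0 by rewrite coef_poly GX0 G0 mulr0 subr0 mul0r.
have hW i : W`_i \in pint p.
  rewrite coef_poly; case: ltnP => [lt_in|_]; last by rewrite rpred0.
  rewrite -opprB mulNr rpredN; apply: eq_pint (hg i).
  rewrite coef_poly lt_in coef_comp_poly_Xn //; case: ifP => // _.
  by rewrite coef_poly (leq_ltn_trans (leq_div _ _) lt_in).
have [E0 hE] := is_exp_trunc n G0; move: (exp_trunc n G) E0 hE => E E0 hE.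
have hV := exp_trunc_scale_pint n hW W0.
have pW0 : (p%:R *: W)`_0 = 0 by rewrite coefZ W0 mulr0.
have [V0 hV'] := is_exp_trunc n pW0; move: (exp_trunc n _) V0 hV' hV => V V0 hV' hV.
have eqE : forall i, (i <= n)%N -> (E ^+ p)`_i = ((E \Po 'X^p) * V)`_i.
  apply: (@is_exp_uniq n (G *+ p) ((G \Po 'X^p) + p%:R *: W)).
  - move=> i le_in; rewrite coefMn coefD coefZ [W`_i]coef_poly ltnS le_in.
    by rewrite [_ * (_ / _)]mulrC divfK // addrC subrK mulr_natl.
  - exact: is_expX.
  - by apply: is_expM => //; apply: is_exp_compXn.
suff : forall m, (m <= n)%N -> E`_m \in pint p by apply.
elim/ltn_ind=> -[_ _|m IH le_mn]; first by rewrite E0 rpred1.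
set T := take_poly m.+1 E; set D := drop_poly m.+1 E.
have eED : E = T + D * 'X^(m.+1) by rewrite poly_take_drop.
have T0 : T`_0 = 1 by rewrite coef_take_poly.
have D0 : D`_0 = E`_m.+1 by rewrite coef_drop_poly.
have hT : T \is a polyOver (pint p).
  apply/polyOverP => i; rewrite coef_take_poly; case: ltnP => [lt_im|_];
    last by rewrite rpred0.
  by apply: IH => //; lia.
(* E - T starts at X^(m+1), and its cofactor in E^p - T^p has constant term p, as E and T both start
   with 1. *)
have eL : (E ^+ p)`_m.+1 = (T ^+ p)`_m.+1 + p%:R * E`_m.+1.
  apply/eqP; rewrite addrC -subr_eq -coefB subrXX.
  have -> : E - T = D * 'X^(m.+1) by rewrite {1}eED addrAC subrr add0r.
  rewrite mulrAC coefMXn ltnn subnn coef0M D0 mulrC.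
  rewrite coef_sum (eq_bigr (fun=> 1)) ?sumr_const ?card_ord //.
  by move=> i _; rewrite coef0M !coef0X E0 T0 !expr1n mulr1.
have eR : (((E \Po 'X^p) * V)`_m.+1 - (T \Po 'X^p)`_m.+1) / p%:R \in pint p.
  rewrite coefM big_ord_recr /= subnn V0 mulr1.
  have -> : (E \Po 'X^p)`_m.+1 = (T \Po 'X^p)`_m.+1.
    rewrite !coef_comp_poly_Xn // coef_take_poly; case: ifP => // _.
    by rewrite ltn_Pdiv // prime_gt1.
  rewrite addrK mulr_suml; apply: rpred_sum => i _; rewrite -mulrA rpredM //.
    rewrite coef_comp_poly_Xn //; case: ifP => _; last by rewrite rpred0.
    apply: IH; have := leq_div i p; have := ltn_ord i; lia.
  by apply: hV; have := ltn_ord i; lia.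
have /polyOverP/(_ m.+1) := poly_frobenius pp hT; rewrite coefZ coefB => hF.
have -> : E`_m.+1 = (((E \Po 'X^p) * V)`_m.+1 - (T \Po 'X^p)`_m.+1) / p%:R
    - p%:R^-1 * ((T ^+ p)`_m.+1 - (T \Po 'X^p)`_m.+1).
  by rewrite -eqE // eL; field.
by rewrite rpredB.
Qed.

End DieudonneDwork.

(** * Dwork's congruences *)

Lemma sum_mulnr (V : nmodType) (f : nat -> V) q p :
  \sum_(i < q * p) f i = \sum_(u < q) \sum_(v < p) f (u * p + v)%N.
Proof.
elim: q => [|q IH]; first by rewrite !big_ord0.
rewrite big_ord_recr /= -IH -!(big_mkord xpredT f) mulSnr.
rewrite (big_cat_nat (n := (q * p)%N)) ?leq_addr //=; congr (_ + _).
by rewrite -{1}[(q * p)%N]add0n big_addn addKn big_mkord; apply: eq_bigr => v _;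
  rewrite addnC.
Qed.

Section Dwork.

Variables (p : nat) (B : nat -> rat).
Hypotheses (pp : prime p) (B_neq0 : forall m, B m != 0) (B0 : B 0%N = 1).
Let R v M := B (p * M + v)%N / B M.
Hypothesis R_pint : forall v M, (v < p)%N -> R v M \in pint p.
Hypothesis R_cong : forall v M m s, (v < p)%N ->
  (R v (m * p ^ s + M)%N - R v M) / p%:R ^+ s.+1 \in pint p.

Let p0 : (0 < p)%N. Proof. exact: prime_gt0. Qed.
Let pu : p%:R != 0 :> rat. Proof. by rewrite pnatr_eq0 -lt0n. Qed.
Let puX s : p%:R ^+ s != 0 :> rat. Proof. by rewrite expf_neq0. Qed.

(** Each base-p digit of [u] peels off one integral ratio [R], until only [B m] remains. *)
Lemma dwork_dvd m s u : (u < p ^ s)%N -> B (m * p ^ s + u)%N / B m \in pint p.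
Proof.
elim: s u => [|s IH] u lt_u.
  have -> : u = 0%N by move: lt_u; rewrite expn0; lia.
  by rewrite muln1 addn0 divff ?rpred1.
have lt_v := ltn_pmod u p0.
have lt_u' : (u %/ p < p ^ s)%N by rewrite ltn_divLR // -expnSr.
have -> : (m * p ^ s.+1 + u = p * (m * p ^ s + u %/ p) + u %% p)%N.
  by rewrite {1}(divn_eq u p) expnS; ring.
have := rpredM (R_pint (m * p ^ s + u %/ p)%N lt_v) (IH _ lt_u').
by rewrite /R mulrA divfK.
Qed.

Lemma dwork_pint m : B m \in pint p.
Proof.
have := @dwork_dvd 0%N m m; rewrite mul0n add0n B0 divr1; apply.
by rewrite ltn_expl ?prime_gt1.
Qed.

Variable a : nat.
Hypothesis lt_ap : (a < p)%N.

(** The truncation at [K] lets blocks of length p^s overrun the range; within it the term changes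
    sign under j -> K - j. *)
Definition dwork_term K j : rat :=
  if (j <= K)%N
  then B (p * (K - j) + a)%N * B j - B (K - j)%N * B (p * j + a)%N else 0.

Definition dwork_block K s m : rat :=
  \sum_(i < p ^ s) dwork_term K (m * p ^ s + i).

Lemma dwork_block0 K m : dwork_block K 0 m = dwork_term K m.
Proof.
by rewrite /dwork_block big_ord1; congr dwork_term; rewrite /= expn0 muln1 addn0.
Qed.

(* t = 0 compares the two blocks term by term; t = s compares the block m, shifted
   by m p^s, with B m times the block 0. *)
Lemma dwork_block_shift K s m (t : nat) :
  (forall t K m, (t < s)%N ->
     dwork_block K t m / (p%:R ^+ t.+1 * B m) \in pint p) ->
  (t <= s)%N ->
  (dwork_block (m * p ^ s + K) s m -
    \sum_(i < p ^ (s - t)) B (m * p ^ (s - t) + i)%N / B i * dwork_block K t i)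
   / (p%:R ^+ s.+1 * B m) \in pint p.
Proof.
move=> IH; elim: t => [|t IHt] le_ts.
  rewrite subn0 {1}/dwork_block -sumrB mulr_suml; apply: rpred_sum => i _.
  rewrite dwork_block0 /dwork_term leq_add2l subnDl.
  case: ifP => [le_iK|_]; last by rewrite mulr0 subr0 mul0r rpred0.
  (* The products containing B(p(K-i)+a) cancel, which leaves -B(K-i) B(m p^s + i) times the change
     of [R a] from i to m p^s + i. *)
  have := rpredM (rpredM (dwork_pint (K - i)) (dwork_dvd m (ltn_ord i)))
     (@R_cong a i m s lt_ap).
  rewrite -rpredN; by apply: eq_pint; rewrite /R; field; rewrite ?B_neq0 ?puX ?pu.
have lt_ts := le_ts; have {IHt} := IHt (ltnW le_ts).
have -> : (s - t = (s - t.+1).+1)%N by lia.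
set r := (s - t.+1)%N.
rewrite expnSr (sum_mulnr (fun i =>
  B (m * (p ^ r * p) + i)%N / B i * dwork_block K t i)).
move=> /rpredD; set X := dwork_block _ _ _; set c := p%:R ^+ _ * _.
set S1 := bigop _ _ _; set S2 := bigop _ _ _.
have -> : (X - S2) / c = (X - S1) / c + (S1 - S2) / c by ring.
apply; rewrite -sumrB mulr_suml; apply: rpred_sum => u _.
have -> : dwork_block K t.+1 u = \sum_(v < p) dwork_block K t (u * p + v).
  rewrite /dwork_block expnS (sum_mulnr (fun i =>
    dwork_term K (u * (p * p ^ t) + i))).
  apply: eq_bigr => v _; apply: eq_bigr => i _; congr dwork_term; ring.
rewrite mulr_sumr -sumrB mulr_suml; apply: rpred_sum => v _.
(* The weights of indices u p + v and u differ by a multiple of the change of [R v] from u to m p^r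
   + u, divisible by p^(r+1); the block carries p^(t+1), and r + t + 2 = s + 1. *)
have := rpredM (rpredM (dwork_dvd m (ltn_ord u))
   (@R_cong v u m r (ltn_ord v))) (IH t K (u * p + v)%N lt_ts).
have -> : (m * (p ^ r * p) + (u * p + v) = p * (m * p ^ r + u) + v)%N by ring.
apply: eq_pint; rewrite /R /c [(u * p)%N]mulnC.
have -> : p%:R ^+ s.+1 = p%:R ^+ r.+1 * p%:R ^+ t.+1 :> rat.
  by rewrite -exprD; congr (_ ^+ _); rewrite /r; lia.
by field; rewrite ?B_neq0 ?puX ?pu.
Qed.

(** The reflection j -> K - j negates each term with j <= K, so their sum is its own opposite. *)
Lemma dwork_total0 K s M : (K < M * p ^ s)%N -> \sum_(m < M) dwork_block K s m = 0.
Proof.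
move=> lt_K; rewrite -sum_mulnr.
rewrite -(big_mkord xpredT) (big_cat_nat (n := K.+1)) //=.
rewrite [X in _ + X]big_nat_cond [X in _ + X]big1 ?addr0; last first.
  by move=> j /andP[/andP[ltKj _] _]; rewrite /dwork_term leqNgt ltKj.
rewrite big_mkord; set S := bigop _ _ _.
suff : S = - S by move/eqP; rewrite -addr_eq0 -mulr2n mulrn_eq0 /= => /eqP.
rewrite {1}/S (reindex_inj rev_ord_inj) -sumrN; apply: eq_bigr => j _ /=.
have le_jK : (j <= K)%N by rewrite -ltnS.
by rewrite subSS /dwork_term leq_subr le_jK subKn //; ring.
Qed.

(** Induction on s: [dwork_block_shift] at t = s carries block 0 to block m, and block 0 is handled
    by a second induction on K. *)
Theorem dwork_congruence K s m :
  dwork_block K s m / (p%:R ^+ s.+1 * B m) \in pint p.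
Proof.
elim/ltn_ind: s K m => s IH.
have shift K m : dwork_block K s 0 / p%:R ^+ s.+1 \in pint p ->
    dwork_block (m * p ^ s + K) s m / (p%:R ^+ s.+1 * B m) \in pint p.
  move=> h; have := dwork_block_shift K m (fun t K m lt => IH t lt K m) (leqnn s).
  rewrite subnn expn0 big_ord1 muln1 addn0 B0 => /rpredD/(_ h).
  by apply: eq_pint; field; rewrite ?B_neq0 ?puX ?pu.
have lower K m : (K < m * p ^ s)%N -> dwork_block K s m = 0.
  move=> lt; rewrite /dwork_block big1 // => i _; rewrite /dwork_term.
  by case: leqP => //; lia.
(* The blocks add up to 0 and every later one reduces, by the shift, to the block
   0 for a smaller K. *)
have zero K : dwork_block K s 0 / p%:R ^+ s.+1 \in pint p.
  elim/ltn_ind: K => K IHK.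
  have : (K < K.+1 * p ^ s)%N by rewrite leq_pmulr ?expn_gt0 ?p0.
  move/dwork_total0/eqP; rewrite big_ord_recl /= addr_eq0 => /eqP->.
  rewrite mulNr rpredN mulr_suml; apply: rpred_sum => i _; rewrite /bump /= add1n.
  case: (ltnP K (i.+1 * p ^ s)) => [/lower->|le]; first by rewrite mul0r rpred0.
  have := @shift (K - i.+1 * p ^ s)%N i.+1; rewrite subnKC // => hs.
  have ps0 : (0 < i.+1 * p ^ s)%N by rewrite muln_gt0 /= expn_gt0 p0.
  have := rpredM (hs (IHK _ _)) (dwork_pint i.+1) => h.
  apply: eq_pint (h _); last lia.
  by field; rewrite ?B_neq0 ?puX ?pu.
move=> K m; case: (ltnP K (m * p ^ s)) => [/lower->|le].
  by rewrite mul0r rpred0.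
by rewrite -(subnKC le); apply: shift.
Qed.

(** Abel summation over p-adic blocks: [w] is frozen at the start of each block. Passing from level
    s to level s+1 costs a difference of weights times a block sum, which [hw] and Dwork's
    congruence control. *)
Lemma dwork_weighted (w : nat -> rat) (c : rat) K : c != 0 ->
  (forall s u v, (v < p)%N ->
    (w ((u * p + v) * p ^ s)%N - w (u * p ^ s.+1)%N) *
      (p%:R ^+ s.+1 * B (u * p + v)%N) / c \in pint p) ->
  (\sum_(j < K.+1) w j * dwork_term K j) / c \in pint p.
Proof.
move=> c0 hw.
have key s m : (\sum_(i < p ^ s) w (m * p ^ s + i)%N * dwork_term K (m * p ^ s + i)
    - w (m * p ^ s)%N * dwork_block K s m) / c \in pint p.
  elim: s m => [|s IH] m.
    rewrite dwork_block0 big_ord1 [(_ + _)%N](_ : _ = (m * p ^ 0)%N) ?addn0 //.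
    by rewrite expn0 muln1 subrr mul0r rpred0.
  have -> : dwork_block K s.+1 m = \sum_(v < p) dwork_block K s (m * p + v).
    rewrite /dwork_block expnS (sum_mulnr (fun i =>
      dwork_term K (m * (p * p ^ s) + i))).
    apply: eq_bigr => v _; apply: eq_bigr => i _; congr dwork_term; ring.
  rewrite [(p ^ s.+1)%N]expnS.
  rewrite (sum_mulnr (fun i => w (m * (p * p ^ s) + i)%N * dwork_term K (m * (p
    * p ^ s) + i))).
  rewrite mulr_sumr -sumrB mulr_suml; apply: rpred_sum => v _.
  have := rpredD (IH (m * p + v)%N)
    (rpredM (hw s m v (ltn_ord v)) (dwork_congruence K s (m * p + v)%N)).
  have e i : ((m * p + v) * p ^ s + i = m * (p * p ^ s) + (v * p ^ s + i))%N.
    by ring.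
  rewrite [(p ^ s.+1)%N]expnS.
  under eq_bigr do rewrite e.
  by apply: eq_pint; field; rewrite ?B_neq0 ?puX ?pu ?c0.
(* As K < p^K, the single block of level K contains the whole sum, and its unweighted total is 0. *)
have lt_K : (K < 1 * p ^ K)%N by rewrite mul1n ltn_expl ?prime_gt1.
have := key K 0%N; have := dwork_total0 lt_K; rewrite big_ord1 => ->.
rewrite mulr0 subr0 mul0n; apply: eq_pint; congr (_ / _).
rewrite -!(big_mkord xpredT (fun i => w i * dwork_term K i)).
rewrite (big_cat_nat (n := K.+1)) //=; last by rewrite -[(p ^ K)%N]mul1n.
rewrite [X in _ + X]big_nat_cond [X in _ + X]big1 ?addr0 //.
by move=> j /andP[/andP[ltKj _] _]; rewrite /dwork_term leqNgt ltKj mulr0.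
Qed.

End Dwork.

(** * The factorial ratios and the harmonic numbers at a prime *)

Lemma eqn_modMmn d a b a' b' :
  a = a' %[mod d] -> b = b' %[mod d] -> (a * b = a' * b' %[mod d])%N.
Proof. by move=> ea eb; rewrite -modnMm ea eb modnMm. Qed.

Lemma eqn_mod_prod d n (F G : nat -> nat) :
  (forall i, F i = G i %[mod d]) ->
  (\prod_(i < n) F i = \prod_(i < n) G i %[mod d])%N.
Proof.
move=> FG; apply: (big_ind2 (fun a b => a = b %[mod d])) => //.
by move=> *; apply: eqn_modMmn.
Qed.

Lemma eqn_modX d a b n : a = b %[mod d] -> (a ^ n = b ^ n %[mod d])%N.
Proof. by move=> ab; rewrite -modnXm ab modnXm. Qed.

Lemma eqn_mod_int (x y d : nat) : x = y %[mod d] ->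
  (x%:R - y%:R) / d%:R \is a @Num.int rat.
Proof.
move=> exy; have [->|d0] := posnP d; first by rewrite invr0 mulr0 rpred0.
have du : d%:R != 0 :> rat by rewrite pnatr_eq0 -lt0n.
rewrite (divn_eq x d) (divn_eq y d) exy !natrD !natrM.
have -> : forall a b c e : rat, e != 0 -> (a * e + c - (b * e + c)) / e = a - b.
  by move=> a b c e e0; field.
- by rewrite rpredB ?natr_int.
- by [].
Qed.


Lemma harmonicS n : harmonic n.+1 = harmonic n + n.+1%:R^-1.
Proof. by rewrite /harmonic big_nat_recr. Qed.

(** The harmonic difference adds the reciprocals of the factors of [pochn b t], so each summand
    cancels one factor. *)
Lemma pochn_harmonic_int b t :
  (pochn b t)%:R * (harmonic (b + t) - harmonic b) \is a Num.int.
Proof.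
elim: t => [|t IH]; first by rewrite addn0 subrr mulr0 rpred0.
rewrite pochnS natrM addnS harmonicS.
have u : (b + t).+1%:R != 0 :> rat by rewrite pnatr_eq0.
have -> : (pochn b t)%:R * (b + t).+1%:R *
   (harmonic (b + t) + (b + t).+1%:R^-1 - harmonic b) =
   (b + t).+1%:R * ((pochn b t)%:R * (harmonic (b + t) - harmonic b))
     + (pochn b t)%:R.
  by move: (_.+1%:R : rat) u => x u; field.
by rewrite rpredD ?natr_int // rpredM ?natr_int.
Qed.

Section AtPrime.

Variable p : nat.
Hypothesis pp : prime p.
Let p0 : (0 < p)%N. Proof. exact: prime_gt0. Qed.
Let pu : p%:R != 0 :> rat. Proof. by rewrite pnatr_eq0 -lt0n. Qed.
Let puX s : p%:R ^+ s != 0 :> rat. Proof. by rewrite expf_neq0. Qed.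

Lemma coprime_neq0 d : coprime p d -> d%:R != 0 :> rat.
Proof.
rewrite pnatr_eq0; apply: contraTneq => ->.
by rewrite /coprime gcdn0 gtn_eqF ?prime_gt1.
Qed.

Lemma pint_cong_frac e (a b a' b' : nat) : coprime p b -> coprime p b' ->
  (a' * b = a * b' %[mod p ^ e])%N ->
  (a'%:R / b'%:R - a%:R / b%:R) / p%:R ^+ e \in pint p.
Proof.
move=> pb pb' /eqn_mod_int; rewrite !natrM natrX => h.
apply: eq_pint (rpredM (pint_int p h) (rpredM (pintV pb) (pintV pb'))).
by field; rewrite puX !coprime_neq0.
Qed.

Lemma pint_congX c x y k : x \in pint p -> y \in pint p ->
  (x - y) / c \in pint p -> (x ^+ k - y ^+ k) / c \in pint p.
Proof.
move=> px py xy; rewrite subrXX mulrAC rpredM //.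
by apply: rpred_sum => i _; rewrite rpredM ?rpredX.
Qed.

(** Moving M by p^s shifts each tail factor by p^(s+1), so every period multiplies by the same unit.
    Its value is left unevaluated, because it cancels in [multinom_unit_cong]. *)
Lemma pfree_fact_period s m v M :
  (pfree_fact p v (m * p ^ s + M) = pfree_fact p v M * pfree_fact p 0 (p ^ s) ^ m
    %[mod p ^ s.+1])%N.
Proof.
have split w n : pfree_fact p w n = (pfree_fact p 0 n * \prod_(l < w) (p * n
  + l.+1))%N.
  by rewrite /pfree_fact big_ord0 muln1.
have tail w n : (\prod_(l < w) (p * (p ^ s + n) + l.+1) =
    \prod_(l < w) (p * n + l.+1) %[mod p ^ s.+1])%N.
  apply: (@eqn_mod_prod _ _ (fun l => p * (p ^ s + n) + l.+1)%N
    (fun l => p * n + l.+1)%N) => l.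
  by rewrite mulnDr -expnS -addnA modnDl.
have one w n : (pfree_fact p w (p ^ s + n) = pfree_fact p w n
  * pfree_fact p 0 (p ^ s)
    %[mod p ^ s.+1])%N.
  elim: n w => [|n IH] w.
    rewrite split [in RHS]split -mulnA [X in (_ = _ * X %[mod _])%N]mulnC mulnA.
    apply: eqn_modMmn; last exact: tail.
    have -> : pfree_fact p 0 0 = 1%N by rewrite /pfree_fact !big_ord0.
    by rewrite addn0 mul1n.
  rewrite split [in RHS]split mulnAC; apply: eqn_modMmn; last exact: tail.
  by rewrite addnS !pfree_factS.
elim: m => [|m IH]; first by rewrite mul0n expn0 muln1.
rewrite mulSn -addnA [(_ ^ m.+1)%N]expnSr mulnA.
rewrite -[RHS]modnMml -IH modnMml; exact: one.
Qed.

Lemma harmonic_mulp M : harmonic (p * M) - harmonic M / p%:R =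
  \sum_(i < M) \sum_(l < p.-1) (p * i + l.+1)%:R^-1.
Proof.
have hD b v : harmonic (b + v) = harmonic b + \sum_(l < v) (b + l.+1)%:R^-1.
  elim: v => [|v IH]; first by rewrite big_ord0 addn0 addr0.
  by rewrite addnS harmonicS big_ord_recr /= IH addrA addnS.
elim: M => [|M IH]; first by rewrite muln0 big_ord0 /harmonic big_nil mul0r subrr.
rewrite big_ord_recr /= -IH harmonicS mulnS addnC.
rewrite -{2}(prednK p0) addnS harmonicS hD -addnS prednK //.
have -> : (p * M + p)%:R = p%:R * M.+1%:R :> rat by rewrite -natrM mulnS addnC.
have : M.+1%:R != 0 :> rat by rewrite pnatr_eq0.
by move: (M.+1%:R : rat) => x x0; field; rewrite pu.
Qed.

Lemma coprime_ltp i v : (0 < v < p)%N -> coprime p (p * i + v).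
Proof.
move=> /andP[v0 vp]; rewrite prime_coprime // dvdn_addr ?dvdn_mulr //.
by apply/negP => /dvdn_leq; lia.
Qed.

Lemma harmonic_ltp v M : (v < p)%N ->
  harmonic (p * M + v) - harmonic M / p%:R \in pint p.
Proof.
elim: v => [|v IH] lt_vp.
  rewrite addn0 harmonic_mulp; apply: rpred_sum => i _; apply: rpred_sum => l _.
  by apply: pintV; apply: coprime_ltp; have := ltn_ord l; lia.
rewrite addnS harmonicS -addnS addrAC; apply: rpredD; first exact: IH (ltnW lt_vp).
by apply/pintV/coprime_ltp.
Qed.

(** * The multinomial coefficients (Nm)!/m!^N *)

Variable N : nat.

Definition multinom (m : nat) : rat := (N * m)`!%:R / (m`!%:R) ^+ N.

Lemma multinom_neq0 m : multinom m != 0.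
Proof.
have f n : n`!%:R != 0 :> rat by rewrite pnatr_eq0 -lt0n fact_gt0.
by rewrite mulf_neq0 ?invr_eq0 ?expf_neq0.
Qed.

Definition multinom_unit v M : rat :=
  (pfree_fact p (N * v %% p) (N * M + N * v %/ p))%:R / (pfree_fact p v M ^ N)%:R.

(** Writing N (p M + v) = p (N M + [N v / p]) + (N v mod p) lets [fact_pfree_fact] split numerator
    and denominator alike. *)
Lemma multinom_split v M : (v < p)%N ->
  multinom (p * M + v) =
  p%:R ^+ (N * v %/ p) * (pochn (N * M) (N * v %/ p))%:R * multinom_unit v M
    * multinom M.
Proof.
move=> lt_vp; rewrite /multinom /multinom_unit.
have -> : (N * (p * M + v) = p * (N * M + N * v %/ p) + N * v %% p)%N.
  by rewrite mulnDr {1}(divn_eq (N * v) p); ring.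
rewrite !(fact_pfree_fact _ _ p0) fact_pochn.
have : coprime p (pfree_fact p v M) by exact: coprime_pfree_fact.
move: (pfree_fact p v M) (pfree_fact p (N * v %% p) _) (pochn _ _) =>
  d e q /coprime_neq0 d0.
rewrite !(natrM, natrX) !exprMn [(_ + _ %/ _)%N]addnC exprD exprM.
have -> : (p%:R ^+ N) ^+ M = (p%:R ^+ M) ^+ N :> rat by rewrite -!exprM mulnC.
have f : M`!%:R != 0 :> rat by rewrite pnatr_eq0 -lt0n fact_gt0.
by field; rewrite !expf_neq0.
Qed.

Lemma multinom_unit_pint v M : (v < p)%N -> multinom_unit v M \in pint p.
Proof.
move=> lt_vp; apply: rpredM; first exact: rpred_nat.
by rewrite natrX -exprVn rpredX // pintV // coprime_pfree_fact.
Qed.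

Lemma multinom_unit_cong v M m s : (v < p)%N ->
  (multinom_unit v (m * p ^ s + M) - multinom_unit v M) / p%:R ^+ s.+1 \in pint p.
Proof.
move=> lt_vp; apply: pint_cong_frac; rewrite ?coprimeXr ?coprime_pfree_fact //.
have -> : (N * (m * p ^ s + M) + N * v %/ p =
   (N * m) * p ^ s + (N * M + N * v %/ p))%N by ring.
move: (pfree_fact_period s (N * m) (N * v %% p) (N * M + N * v %/ p)).
move: (eqn_modX N (pfree_fact_period s m v M)).
set e := pfree_fact p 0 _; set a := pfree_fact _ _ (_ + (_ + _)); set b :=
  pfree_fact _ _ (_ + M).
set a' := pfree_fact _ _ (_ + _); set b' := pfree_fact _ _ _ => eb ea.
rewrite -modnMml ea modnMml -[RHS]modnMmr eb modnMmr expnMn -expnM [(m * N)%N]mulnC.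
by congr (_ %% _)%N; ring.
Qed.

Definition multinom_ratio v M : rat := multinom (p * M + v) / multinom M.

Lemma multinom_ratioE v M : (v < p)%N -> multinom_ratio v M =
  p%:R ^+ (N * v %/ p) * (pochn (N * M) (N * v %/ p))%:R * multinom_unit v M.
Proof. by move=> lt_vp; rewrite /multinom_ratio multinom_split // mulfK
  ?multinom_neq0. Qed.

Lemma multinom_ratio_pint v M : (v < p)%N -> multinom_ratio v M \in pint p.
Proof.
move=> lt_vp; rewrite multinom_ratioE // rpredM ?multinom_unit_pint //.
by rewrite rpredM ?rpredX ?rpred_nat.
Qed.

Lemma multinom_ratio_cong v M m s : (v < p)%N ->
  (multinom_ratio v (m * p ^ s + M) - multinom_ratio v M) / p%:R ^+ s.+1 \in pint p.
Proof.
move=> lt_vp; rewrite !multinom_ratioE //.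
set t := (N * v %/ p)%N; set U := multinom_unit _ _; set U' := multinom_unit _ _.
pose P x : rat := (p ^ t * pochn (N * x) t)%N%:R.
have hP : (P (m * p ^ s + M)%N - P M) / p%:R ^+ s.+1 \in pint p.
  apply: pint_int; rewrite -natrX; apply: eqn_mod_int.
  (* For t = 0 both values are 1; otherwise a factor of p^t raises the congruence of the rising
     factorials from modulus p^s to p^(s+1). *)
  case: t {P} => [|t]; first by rewrite /pochn !big_ord0.
  rewrite !expnS -!mulnA -!muln_modr; congr (_ * _)%N.
  apply: eqn_modMmn => //.
  apply: (@eqn_mod_prod _ _ (fun l => N * (m * p ^ s + M) + l.+1)%N
    (fun l => N * M + l.+1)%N) => l.
  by rewrite mulnDr mulnA -addnA modnMDl.
have := rpredD (rpredM hP (multinom_unit_pint (m * p ^ s + M)%N lt_vp))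
   (rpredM (rpred_nat (pint p) (p ^ t * pochn (N * M) t))
       (multinom_unit_cong M m s lt_vp)).
rewrite /P !natrM !natrX -/U -/U'; apply: eq_pint; ring.
Qed.

Lemma multinom1 : multinom 1 = N`!%:R.
Proof. by rewrite /multinom muln1 expr1n divr1. Qed.

Lemma fact_floor_pfree : N`!%:R = p%:R ^+ (N %/ p) * (N %/ p)`!%:R
   * (pfree_fact p (N %% p) (N %/ p))%:R :> rat.
Proof.
by rewrite {1}(divn_eq N p) mulnC fact_pfree_fact // natrM natrM natrX.
Qed.

Let f_neq0 n : n`!%:R != 0 :> rat.
Proof. by rewrite pnatr_eq0 -lt0n fact_gt0. Qed.

Lemma le_floor v : (0 < v)%N -> (N %/ p <= N * v %/ p)%N.
Proof. by move=> v0; rewrite leq_div2r // leq_pmulr. Qed.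

Lemma le_floor2 v : (1 < v)%N -> (N %/ p + N %/ p <= N * v %/ p)%N.
Proof.
move=> v1; rewrite leq_divRL // mulnDl.
apply: (@leq_trans (N + N)); first by rewrite leq_add ?leq_trunc_div.
by rewrite addnn -muln2 leq_mul.
Qed.

(** Up to units, [multinom v] is p^q q! with q = [N v / p] and N! is p^n n! with n = [N / p] <= q;
    the quotient q!/n! is a rising factorial. *)
Lemma multinom_small v : (0 < v < p)%N -> exists2 u, u \in pint p &
  multinom v / N`!%:R = p%:R ^+ (N * v %/ p - N %/ p)
    * (pochn (N %/ p) (N * v %/ p - N %/ p))%:R * u.
Proof.
move=> /andP[v0 lt_vp]; have le := le_floor v0.
have := @multinom_split v 0 lt_vp; rewrite muln0 add0n => ->.
have cd : coprime p (pfree_fact p (N %% p) (N %/ p)).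
  by rewrite coprime_pfree_fact // ltn_pmod.
exists (multinom_unit v 0 / (pfree_fact p (N %% p) (N %/ p))%:R).
  by rewrite rpredM ?multinom_unit_pint ?pintV.
have e : pochn 0 (N * v %/ p) =
   ((N %/ p)`! * pochn (N %/ p) (N * v %/ p - N %/ p))%N.
  by rewrite -fact_pochn subnKC // -[LHS]mul1n -fact0 -fact_pochn.
rewrite muln0 e natrM fact_floor_pfree -{1}(subnKC le) exprD.
have -> : multinom 0 = 1 by rewrite /multinom muln0 fact0 expr1n divr1.
by field; rewrite puX f_neq0 coprime_neq0.
Qed.

(** Removing the last base-p digit drops only integral factors; this ends at the leading digit,
    where [multinom_small] applies. *)
Lemma multinom_dvd_fact m : (0 < m)%N -> multinom m / N`!%:R \in pint p.
Proof.
elim/ltn_ind: m => m IH m0.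
have lt_vp : (m %% p < p)%N by rewrite ltn_pmod.
have em : m = (p * (m %/ p) + m %% p)%N by rewrite mulnC -divn_eq.
case: (posnP (m %/ p)) => M0.
  have lt_mp : (m < p)%N by rewrite em M0 muln0.
  have [|u pu' ->] := @multinom_small m; first by rewrite m0.
  by rewrite !rpredM ?rpredX ?rpred_nat.
rewrite em multinom_split // -mulrA; apply: rpredM.
  by apply: rpredM (multinom_unit_pint _ lt_vp); rewrite rpredM ?rpredX ?rpred_nat.
by apply: IH => //; rewrite ltn_Pdiv ?prime_gt1.
Qed.

Definition harmonic_gap (m : nat) : rat := harmonic (N * m) - harmonic m.

Variable xi : int.
Hypothesis xi_le : xi <= (N %/ p).-1%:Z.
Hypothesis hxi : (harmonic N - 1) / p%:R ^ xi \in pint p.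

(** One factor of p^t clears the 1/p and [pochn] clears the harmonic difference; the remaining t - 1
    >= [N/p] - 1 >= xi factors give the divisibility. *)
Lemma pochn_harmonic_pint b t y : (N %/ p <= t)%N -> y \in pint p ->
  p%:R ^+ t * (pochn b t)%:R * ((harmonic (b + t) - harmonic b) / p%:R + y)
   / p%:R ^ xi \in pint p.
Proof.
move=> le_t py.
have pz (j : nat) : xi <= j%:Z -> p%:R ^+ j / p%:R ^ xi \in pint p.
  move=> le; rewrite exprnP invr_expz -expfzDr //.
  by rewrite -[_ - _]gez0_abs ?subr_ge0 // -exprnP rpredX ?rpred_nat.
have := rpredM (rpredM (pz t _) (rpred_nat _ (pochn b t))) py.
(* For t = 0 the harmonic difference vanishes, and [N/p] = 0 forces xi <= 0. *)
case: t le_t => [|t] le_t.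
  rewrite addn0 subrr mul0r add0r => h.
  by apply: eq_pint (h _); [ring | lia].
move=> h1; have h2 := rpredM (pz t _) (pint_int p (pochn_harmonic_int b t.+1)).
have := rpredD (h1 _) (h2 _); move: (harmonic _ - _) => h h3.
by apply: eq_pint (h3 _ _); [rewrite exprS; field; rewrite pu expfz_neq0 | lia..].
Qed.

(** For M > 0 the change of [harmonic_gap] is, up to integral terms, 1/p times the harmonic
    difference over the very range of the rising factorial in [multinom_split], so
    [pochn_harmonic_pint] applies. *)
Lemma multinom_harmonic_pint M v : (0 < v < p)%N ->
  multinom (p * M + v) / N`!%:R * (harmonic_gap (p * M + v) - harmonic_gap (p
    * M)) / p%:R ^ xi \in pint p.
Proof.
move=> /andP[v0 lt_vp]; have rp : (N * v %% p < p)%N by rewrite ltn_pmod.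
have lt0v : (0 < v < p)%N by rewrite v0.
have e M' : (N * (p * M' + v) = p * (N * M' + N * v %/ p) + N * v %% p)%N.
  by rewrite mulnDr {1}(divn_eq (N * v) p); ring.
have [M0|M0] := posnP M; last first.
  set D := harmonic_gap _ - harmonic_gap _.
  pose y := D - (harmonic (N * M + N * v %/ p) - harmonic (N * M)) / p%:R.
  have py : y \in pint p.
    have := rpredB (harmonic_ltp (N * M + N * v %/ p) rp) (harmonic_ltp M lt_vp).
    move/rpredB => /(_ _ (harmonic_ltp (N * M) p0)).
    move/rpredD => /(_ _ (harmonic_ltp M p0)).
    rewrite -e !addn0; apply: eq_pint; rewrite /y /D /harmonic_gap.
    have -> : (N * (p * M) = p * (N * M))%N by ring.
    by ring.
  have := pochn_harmonic_pint (N * M) (le_floor v0) py.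
  rewrite /y addrC subrK => h.
  have := rpredM h (rpredM (multinom_unit_pint M lt_vp) (multinom_dvd_fact M0)).
  by apply: eq_pint; rewrite multinom_split //; field; rewrite f_neq0 expfz_neq0.
(* At M = 0, the case v = 1 is the hypothesis on H_N - 1. For v > 1 the range above [N/p] has length
   t >= [N/p], so the same argument treats the change from 1 to v. *)
rewrite M0 muln0 add0n.
have harmonic_gap0 : harmonic_gap 0 = 0 by rewrite /harmonic_gap muln0 subrr.
have harmonic_gap1 : harmonic_gap 1 = harmonic N - 1.
  by rewrite /harmonic_gap muln1; congr (_ - _); rewrite /harmonic big_nat1 invr1.
rewrite harmonic_gap0 subr0; have [v1|v1] := eqVneq v 1%N.
  by rewrite v1 multinom1 harmonic_gap1 divff // mul1r.
have {}v1 : (1 < v)%N by lia.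
have [u pu' eb] := multinom_small lt0v.
set t := (N * v %/ p - N %/ p)%N in eb.
have le := le_floor2 v1.
have et : (N %/ p + t = N * v %/ p)%N by rewrite /t subnKC // le_floor.
pose y := harmonic_gap v - harmonic_gap 1 - (harmonic (N %/ p + t)
  - harmonic (N %/ p)) / p%:R.
have py : y \in pint p.
  have p1 := prime_gt1 pp.
  have rp' : (N %% p < p)%N by rewrite ltn_pmod.
  have := rpredB (harmonic_ltp (N * 0 + N * v %/ p) rp) (harmonic_ltp 0 lt_vp).
  move/rpredB => /(_ _ (harmonic_ltp (N %/ p) rp')).
  move/rpredD => /(_ _ (harmonic_ltp 0 p1)).
  rewrite -e !muln0 !add0n [(p * _)%N]mulnC -divn_eq; apply: eq_pint.
  rewrite /y et /harmonic_gap muln1; move: (harmonic 0) (harmonic 1) (harmonic _).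
  by move: (harmonic _) (harmonic _) (harmonic _) (harmonic _) => *; ring.
have le_t : (N %/ p <= t)%N by rewrite /t; lia.
have := rpredD (rpredM (pochn_harmonic_pint (N %/ p) le_t py) pu') 
  (rpredM hxi (multinom_dvd_fact v0)).
by rewrite eb; apply: eq_pint; rewrite -harmonic_gap1 /y; ring.
Qed.

End AtPrime.

(** * Harmonic sums over blocks of residues *)

Lemma pint_dvd p d e (a : nat) : coprime p d -> (0 < p)%N ->
  a%:R / d%:R / p%:R ^+ e \in pint p -> (p ^ e %| a)%N.
Proof.
move=> pd p0 h; have [d0|d0] := eqVneq d 0%N.
  move: pd; rewrite d0 /coprime gcdn0 => /eqP->.
  by rewrite exp1n dvd1n.
have pu : p%:R != 0 :> rat by rewrite pnatr_eq0 -lt0n.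
have du : d%:R != 0 :> rat by rewrite pnatr_eq0.
have [b [pb /intrP[m hm]]] := pint_denP (rpredM h (rpred_nat (pint p) d)).
have e1 : (a * b)%N%:Z = m * (p ^ e)%N%:Z.
  apply: (@intr_inj rat); rewrite intrM -hm -!pmulrn natrM natrX.
  by field; rewrite du expf_neq0.
rewrite -(@Gauss_dvdl _ _ b) ?coprimeXl //.
by have := congr1 absz e1; rewrite abszM !absz_nat => ->; rewrite dvdn_mull.
Qed.

Definition harmonic_block (p i : nat) : rat := \sum_(l < p.-1) (p * i + l.+1)%:R^-1.

Lemma harmonic_block_pint p i : prime p -> harmonic_block p i \in pint p.
Proof.
move=> pp; apply: rpred_sum => l _; apply/pintV/coprime_ltp => //.
by have := ltn_ord l; lia.
Qed.

Section Wolstenholme.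

Variable p : nat.
Hypotheses (pp : prime p) (p_odd : odd p).
Let p0 : (0 < p)%N. Proof. exact: prime_gt0. Qed.
Let pu : p%:R != 0 :> rat. Proof. by rewrite pnatr_eq0 -lt0n. Qed.

Let p2 : coprime p 2. Proof. by rewrite coprimen2. Qed.
Let half : 2%:R^-1 \in pint p. Proof. exact: pintV. Qed.

Let cl i (l : 'I_p.-1) : coprime p (p * i + l.+1).
Proof. by apply: coprime_ltp => //; have := ltn_ord l; lia. Qed.
Let cl' i (l : 'I_p.-1) : coprime p (p * i + (p - l.+1)).
Proof. by apply: coprime_ltp => //; have := ltn_ord l; lia. Qed.

(** Pair l with p - l: the two denominators add up to p (2i+1). *)
Lemma harmonic_block_double i : 2%:R * harmonic_block p i =
  p%:R * (2 * i + 1)%:R *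
  \sum_(l < p.-1) ((p * i + l.+1) * (p * i + (p - l.+1)))%:R^-1.
Proof.
have e : 2%:R * harmonic_block p i = harmonic_block p i
  + harmonic_block p i by ring.
rewrite e {2}/harmonic_block (reindex_inj rev_ord_inj) /= -big_split /= mulr_sumr.
apply: eq_bigr => l _; have := ltn_ord l => lt_l.
have -> : (p.-1 - l.+1).+1 = (p - l.+1)%N by lia.
have := cl i l; have := cl' i l => /(coprime_neq0 pp) u /(coprime_neq0 pp) v.
have e2 : (p * (2 * i + 1) = (p * i + l.+1) + (p * i + (p - l.+1)))%N.
  have aux x y : ((x + y) * (2 * i + 1) = ((x + y) * i + y) + ((x + y) * i + x))%N.
    by ring.
  by have := aux (p - l.+1)%N l.+1; rewrite subnK //; lia.
rewrite -natrM e2; move: (_ + (_ - _))%N u (_ + l.+1)%N v => x x0 y y0.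
by rewrite natrD natrM; field; rewrite x0 y0.
Qed.


(** Since (pi+l)(pi+p-l) = l(p-l) + p^2 i(i+1), the sums of inverses of these products for i and for
    0 agree mod p^2; [harmonic_block_double] supplies the third p. *)
Lemma harmonic_block_cong i : (harmonic_block p i - (2 * i + 1)%:R
  * harmonic_block p 0) / p%:R ^+ 3 \in pint p.
Proof.
set f : rat := (2 * i + 1)%:R.
pose A j (l : 'I_p.-1) := ((p * j + l.+1) * (p * j + (p - l.+1)))%N.
have cA j l : coprime p (A j l) by rewrite coprimeMr cl cl'.
pose S j : rat := \sum_(l < p.-1) (A j l)%:R^-1.
pose T : rat := \sum_(l < p.-1) (A i l)%:R^-1 * (A 0 l)%:R^-1.
have hT : T \in pint p by apply: rpred_sum => l _; rewrite rpredM ?pintV.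
have eS : S i = S 0 - p%:R ^+ 2 * (i * i.+1)%:R * T.
  rewrite /S /T mulr_sumr -sumrB; apply: eq_bigr => l _.
  have e2 : A i l = (A 0 l + p ^ 2 * (i * i.+1))%N.
    have aux x y : (((x + y) * i + y) * ((x + y) * i + x) =
        ((x + y) * 0 + y) * ((x + y) * 0 + x) + (x + y) ^ 2 * (i * i.+1))%N by ring.
    by have := aux (p - l.+1)%N l.+1; rewrite subnK //; have := ltn_ord l; lia.
  have u := coprime_neq0 pp (cA i l); have v := coprime_neq0 pp (cA 0 l).
  have e3 : (A i l)%:R = (A 0 l)%:R + p%:R ^+ 2 * (i * i.+1)%:R :> rat.
    by rewrite e2 natrD natrM natrX.
  move: u v e3; move: (A i l) (A 0 l) ((i * i.+1)%:R : rat) => x y c u v e3.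
  by field: e3; rewrite u v.
have -> : (harmonic_block p i - f * harmonic_block p 0) / p%:R ^+ 3 = - (f * (i
  * i.+1)%:R / 2%:R * T).
  have -> : harmonic_block p i - f * harmonic_block p 0 = (2%:R
    * harmonic_block p i - f * (2%:R * harmonic_block p 0)) / 2%:R by field.
  rewrite !harmonic_block_double -/f -/(S i) -/(S 0) eS muln0 add0n.
  by move: ((i * i.+1)%:R : rat) f => c {}f; field; rewrite pu.
by rewrite rpredN !rpredM ?rpred_nat.
Qed.

(** The odd numbers 2i+1 with i < n add up to n^2. *)
Lemma sum_harmonic_block_cong n :
  (\sum_(i < n) harmonic_block p i - (n ^ 2)%:R * harmonic_block p 0)
    / p%:R ^+ 3 \in pint p.
Proof.
elim: n => [|n IH]; first by rewrite big_ord0 mul0r subr0 mul0r rpred0.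
have := rpredD IH (harmonic_block_cong n); apply: eq_pint; rewrite big_ord_recr /=.
have -> : (n.+1 ^ 2 = n ^ 2 + (2 * n + 1))%N by ring.
by rewrite natrD; ring.
Qed.

Lemma harmonic_block0_dvd : harmonic_block p 0 / p%:R \in pint p.
Proof.
have -> : harmonic_block p 0 / p%:R = (2%:R * harmonic_block p 0) / 2%:R
  / p%:R by field.
rewrite harmonic_block_double muln0 add0n mulr1.
set S := bigop _ _ _; have -> : p%:R * S / 2%:R / p%:R = S / 2%:R by field.
rewrite rpredM //; apply: rpred_sum => l _; apply: pintV.
by rewrite coprimeMr cl cl'.
Qed.

(** Doubling permutes the residues mod p, so the sum S is congruent to S/4; hence p divides 3S/4,
    and 3 is a unit. The index 0 contributes 0 because its inverse is 0 by convention. *)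
Lemma sum_inv_sqr_dvd : (3 < p)%N ->
  (\sum_(i < p) (i%:R^-1) ^+ 2) / p%:R \in pint p.
Proof.
move=> p3; set S := bigop _ _ _.
have c3 : coprime p 3 by rewrite prime_coprime // gtnNdvd.
have h (i : 'I_p) : ((2 * i) %% p < p)%N by rewrite ltn_pmod.
have inj : injective (fun i : 'I_p => Ordinal (h i)).
  move=> i j /(congr1 val) /= /eqP; apply: contraTeq.
  wlog lt_ij : i j / (i < j)%N => [hw ne_ij|_].
    case: (ltngtP i j) (ne_ij) => [/hw|/hw h'|/val_inj->];
      [exact | | by rewrite eqxx].
    by rewrite eq_sym [_ == _ %[mod _]]eq_sym.
  rewrite eq_sym eqn_mod_dvd ?(leq_mul _ (ltnW lt_ij)) // -mulnBr Gauss_dvdr //.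
  by rewrite gtnNdvd // ?subn_gt0 // (leq_ltn_trans (leq_subr _ _)).
suff : (S - 4%:R^-1 * S) / p%:R \in pint p.
  move=> hS; have := rpredM (rpred_nat (pint p) 4) (rpredM (pintV c3) hS).
  by apply: eq_pint; field.
rewrite {1}/S (reindex_inj inj) mulr_sumr -sumrB mulr_suml.
apply: rpred_sum => i _ /=.
have [->|i0] := posnP i; first by rewrite muln0 mod0n invr0 expr0n /= mulr0 subr0
  mul0r rpred0.
set r := ((2 * i) %% p)%N; set q := ((2 * i) %/ p)%N.
have e : (2 * i = q * p + r)%N by exact: divn_eq.
have ci : coprime p i by have := @coprime_ltp p pp 0 i;
  rewrite muln0 add0n i0 ltn_ord; apply.
have cr : coprime p r by rewrite /r coprime_modr coprimeMr p2 ci.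
have c4 : coprime p 4 by rewrite (@coprimeMr p 2 2) p2.
have iu := coprime_neq0 pp ci; have ru := coprime_neq0 pp cr.
have e' : 2%:R * i%:R = q%:R * p%:R + r%:R :> rat by rewrite -!natrM -natrD e.
have -> : (r%:R^-1 ^+ 2 - 4%:R^-1 * i%:R^-1 ^+ 2) / p%:R =
   4%:R^-1 * (q%:R * (2%:R * i%:R + r%:R)) * (r%:R^-1 ^+ 2) * (i%:R^-1 ^+ 2) :> rat.
  have er : r%:R = 2%:R * i%:R - q%:R * p%:R :> rat by rewrite e' addrC addKr.
  by move: ru; rewrite er => ru; field; rewrite pu iu ru.
by rewrite !rpredM ?rpredX ?rpredD ?rpredM ?rpred_nat ?pintV.
Qed.

(** Wolstenholme's theorem: in the paired sum 1/(l(p-l)) is congruent to -1/l^2 mod p, and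
    [sum_inv_sqr_dvd] gives the second p. *)
Lemma harmonic_block0_dvd2 : (3 < p)%N -> harmonic_block p 0 / p%:R ^+ 2 \in pint p.
Proof.
move=> p3.
have -> : harmonic_block p 0 / p%:R ^+ 2 = (2%:R * harmonic_block p 0) / 2%:R
  / p%:R ^+ 2 by field.
rewrite harmonic_block_double muln0 add0n mulr1.
set S := bigop _ _ _; have -> : p%:R * S / 2%:R / p%:R ^+ 2 = S / p%:R
  / 2%:R by field.
rewrite rpredM //.
have drop0 n : (0 < n)%N ->
    \sum_(i < n) (i%:R^-1) ^+ 2 = \sum_(i < n.-1) (i.+1%:R^-1) ^+ 2 :> rat.
  case: n => // n _; rewrite big_ord_recl /= invr0 expr0n add0r.
  by apply: eq_bigr => i _; rewrite /bump add1n.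
have := sum_inv_sqr_dvd p3; rewrite drop0 // => h.
suff : (S + \sum_(i < p.-1) (i.+1%:R^-1) ^+ 2) / p%:R \in pint p.
  by move/rpredB => /(_ _ h); apply: eq_pint; ring.
rewrite -big_split mulr_suml; apply: rpred_sum => l _ /=; rewrite muln0 !add0n.
have := cl 0 l; have := cl' 0 l; rewrite muln0 !add0n => c' c.
have u := coprime_neq0 pp c; have v := coprime_neq0 pp c'.
have e : p%:R = (p - l.+1)%:R + l.+1%:R :> rat.
  by rewrite -natrD; congr (_%:R); have := ltn_ord l; lia.
have -> : ((l.+1 * (p - l.+1))%:R^-1 + l.+1%:R^-1 ^+ 2) / p%:R =
   (l.+1%:R^-1) ^+ 2 * (p - l.+1)%:R^-1 :> rat.
  rewrite natrM; move: (p%:R : rat) pu ((p - _)%:R : rat) v (l.+1%:R : rat) u e.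
  by move=> x x0 y y0 z z0 e; field: e; rewrite x0 y0 z0.
by rewrite rpredM ?rpredX ?pintV.
Qed.

End Wolstenholme.

(** * Exceptional primes *)

Lemma pint_scaled p e (x : rat) : prime p -> x / p%:R ^+ e \in pint p ->
  x \in pint p.
Proof.
move=> pp h; have pu : p%:R != 0 :> rat by rewrite pnatr_eq0 -lt0n prime_gt0.
apply: eq_pint (rpredM h (rpredX e (rpred_nat (pint p) p))).
by rewrite divfK ?expf_neq0.
Qed.

(** Modulo p-integral numbers H_N is H_[N/p] / p, the contribution of the multiples of p. *)
Lemma harmonic_floor_dvd p N : prime p -> harmonic N \in pint p ->
  harmonic (N %/ p) / p%:R \in pint p.
Proof.
move=> pp hN; have := harmonic_ltp pp (N %/ p) (ltn_pmod N (prime_gt0 pp)).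
rewrite mulnC -divn_eq => /(rpredB hN).
by apply: eq_pint; rewrite opprB addrC subrK.
Qed.

Lemma frac_dvd_prime p d a : coprime p d -> (0 < p)%N ->
  a%:R / d%:R / p%:R \in pint p -> (p %| a)%N.
Proof. by move=> pd p0 h; have := @pint_dvd p d 1 a pd p0 h; rewrite expn1. Qed.

(** Descent from n to [n/2] by [harmonic_floor_dvd] ends at H_1 = 1. *)
Lemma harmonic2_ndvd n : (0 < n)%N -> harmonic n / 2%:R \notin pint 2.
Proof.
elim/ltn_ind: n => n IH n0; apply/negP => hn.
have [n1|n1] := leqP n 1.
  have e : n = 1%N by lia.
  have : 1%:R / 1%:R / 2%:R \in pint 2.
    by apply: eq_pint hn; rewrite e /harmonic big_nat1 invr1 divr1.
  by move/(frac_dvd_prime (coprimen1 2) isT).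
have lt : (n %/ 2 < n)%N by rewrite ltn_Pdiv.
have := IH _ lt; rewrite divn_gt0 // => /(_ n1) /negP; apply.
by apply: harmonic_floor_dvd => //; apply: (@pint_scaled 2 1).
Qed.

(* The Bezout coefficient inverts [i %/ gcdn i c] modulo [q] when the two are
   coprime, so this represents [c / i] modulo [q]. *)
Definition term_residue (c q i : nat) : nat :=
  ((c %/ gcdn i c) * ((egcdn (i %/ gcdn i c) q).1 %% q))%N.

Definition harmonic_residue (c q n : nat) : nat :=
  iteri n (fun i acc => (acc + term_residue c q i.+1) %% q)%N 0%N.

(** The last two tests make c / i p-integral. Multiplying (i t - c) / (c q) from the first test by c
    / i gives (t - c / i) / q, where t is the term residue. *)
Definition residues_ok (p c q n : nat) : bool :=
  all (fun i => [&& i * term_residue c q i == c %[mod c * q],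
                    i %| c * (i %/ gcdn i c) & coprime p (i %/ gcdn i c)])%N
      (iota 1 n).

Lemma harmonic_residueP p c q K n : (0 < c)%N -> (0 < q)%N -> residues_ok p c q K ->
  (n <= K)%N ->
  (c%:R * harmonic n - (harmonic_residue c q n)%:R) / q%:R \in pint p.
Proof.
move=> c0 q0 /allP ok; have qu : q%:R != 0 :> rat by rewrite pnatr_eq0 -lt0n.
have cu : c%:R != 0 :> rat by rewrite pnatr_eq0 -lt0n.
elim: n => [_|n IH lt_nK].
  by rewrite /harmonic big_nil mulr0 subrr mul0r rpred0.
have /ok : n.+1 \in iota 1 K by rewrite mem_iota; lia.
rewrite /= -/(harmonic_residue c q n).
move: (term_residue _ _ _) (harmonic_residue _ _ _) (IH (ltnW lt_nK)) => t T hT.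
case/and3P=> /eqP/eqn_mod_int ht /dvdnP[d ed] cd.
have nu : n.+1%:R != 0 :> rat by rewrite pnatr_eq0.
have hmod : ((T + t)%:R - ((T + t) %% q)%:R) / q%:R \is a @Num.int rat.
  by apply: eqn_mod_int; rewrite modn_mod.
have hc : c%:R / n.+1%:R \in pint p.
  by apply: (pint_den cd); rewrite mulrAC -natrM ed natrM mulfK.
have := rpredB (rpredD hT (pint_int p hmod)) (rpredM (pint_int p ht) hc).
apply: eq_pint; rewrite harmonicS natrD !natrM.
by move: (n.+1%:R : rat) nu => x x0; field; rewrite qu cu x0.
Qed.

(** Here 27 and 11 are the largest powers of 3 and 11 up to the bounds 68 = 3·22 + 2 and 43 = 11·3 +
    10. The moduli 243 = 27·9 and 121 = 11·11 detect divisibility of H_N - 1 by 9 and by 11. *)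
Lemma residues_ok3 : residues_ok 3 27 243 68. Proof. by vm_compute. Qed.
Lemma residues_ok11 : residues_ok 11 11 121 43. Proof. by vm_compute. Qed.

Lemma dvdn_prime_pint p e (m : nat) : prime p -> m%:R / (p ^ e)%:R \in pint p ->
  (p ^ e %| m)%N.
Proof.
move=> pp h; apply: (@pint_dvd p 1 e); rewrite ?coprimen1 ?prime_gt0 //.
by rewrite divr1 -natrX.
Qed.

Lemma harmonic3_small n : (n <= 68)%N -> harmonic n / 3%:R \in pint 3 ->
  n \in [:: 0; 2; 7; 22]%N.
Proof.
move=> le_n h.
have h1 := @harmonic_residueP 3 27 243 68 n isT isT residues_ok3 le_n.
have h2 := rpredB h (rpredM (rpred_nat (pint 3) 3) h1).
have {h2} : (harmonic_residue 27 243 n)%:R / (3 ^ 4)%N%:R \in pint 3.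
  by apply: eq_pint h2; rewrite natrX; field.
move/(@dvdn_prime_pint 3 4 _ isT).
have : all (fun n => (3 ^ 4 %| harmonic_residue 27 243 n)%N ==>
   (n \in [:: 0; 2; 7; 22]%N)) (iota 0 69) by vm_compute.
by move/allP/(_ n) => hn; apply/implyP/hn; rewrite mem_iota.
Qed.

(** If 3 divides H_n it divides H_[n/3], so by induction [n/3] <= 22 and n <= 68, within reach of
    the computation. *)
Lemma harmonic3_dvd n : harmonic n / 3%:R \in pint 3 -> n \in [:: 0; 2; 7; 22]%N.
Proof.
move=> h; apply: harmonic3_small => //.
elim/ltn_ind: n h => n IH h; have [->//|n0] := posnP n.
have lt : (n %/ 3 < n)%N by rewrite ltn_Pdiv.
have h3 := harmonic_floor_dvd (isT : prime 3) (@pint_scaled 3 1 _ isT h).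
have := harmonic3_small (IH _ lt h3) h3.
have := ltn_pmod n (isT : (0 < 3)%N); have := divn_eq n 3.
by move=> en lt_r; rewrite !inE => /or4P[]/eqP e; rewrite e in en; lia.
Qed.

Lemma harmonic3_sub1_ndvd N : (2 <= N <= 68)%N ->
  (harmonic N - 1) / 9%:R \notin pint 3.
Proof.
move=> /andP[N2 le_N]; apply/negP => h.
have h1 := @harmonic_residueP 3 27 243 68 N isT isT residues_ok3 le_N.
have h2 := rpredB (rpredD h (rpred1 _)) h1.
(* 216 stands for -27 mod 243, as 27 (H_N - 1) is tested. *)
have {h2} : (harmonic_residue 27 243 N + 216)%:R / (3 ^ 5)%N%:R \in pint 3.
  by apply: eq_pint h2; rewrite natrX natrD; field.
move/(@dvdn_prime_pint 3 5 _ isT).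
have : all (fun n => ~~ (3 ^ 5 %| harmonic_residue 27 243 n + 216)%N) (iota 2 67)
  by vm_compute.
by move/allP/(_ N) => hn; apply/negP/hn; rewrite mem_iota; lia.
Qed.

Lemma harmonic11_sub1_ndvd N : (33 <= N <= 43)%N ->
  (harmonic N - 1) / 11%:R \notin pint 11.
Proof.
move=> /andP[N33 le_N]; apply/negP => h.
have h1 := @harmonic_residueP 11 11 121 43 N isT isT residues_ok11 le_N.
have h2 := rpredB (rpredD h (rpred1 _)) h1.
(* Likewise 110 stands for -11 mod 121. *)
have {h2} : (harmonic_residue 11 121 N + 110)%:R / (11 ^ 2)%N%:R \in pint 11.
  by apply: eq_pint h2; rewrite natrX natrD; field.
move/(@dvdn_prime_pint 11 2 _ isT).
have : all (fun n => ~~ (11 ^ 2 %| harmonic_residue 11 121 n + 110)%N) (iota 33 11)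
  by vm_compute.
by move/allP/(_ N) => hn; apply/negP/hn; rewrite mem_iota; lia.
Qed.

(** Here p divides H_n for n = [N/p]. That excludes p = 2 and leaves n = 2, 7 or 22 for p = 3. For p
    > 3 and n <= 3, the values 1, 3/2, 11/6 of H_n leave only p = 11, n = 3, excluded by
    computation. *)
Lemma harmonic_sub1_dvd p N : prime p -> (p <= N)%N ->
  (harmonic N - 1) / p%:R \in pint p ->
  [/\ p = 3, 1 < N %/ p & (harmonic N - 1) / 9%:R \notin pint 3]%N
  \/ (3 < p)%N /\ (3 < N %/ p)%N.
Proof.
move=> pp le_pN h; have p0 := prime_gt0 pp.
have hN : harmonic N \in pint p.
  by rewrite -[harmonic N](subrK 1) rpredD ?rpred1 // (@pint_scaled p 1).
have hn := harmonic_floor_dvd pp hN.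
have n0 : (0 < N %/ p)%N by rewrite divn_gt0.
have [p2|p2] := eqVneq p 2%N.
  by move: hn n0; rewrite p2 => hn /harmonic2_ndvd; rewrite hn.
have [p3|p3] := eqVneq p 3%N.
  left; rewrite p3 in hn n0 *.
  have := harmonic3_dvd hn; have := divn_eq N 3; have :=
    ltn_pmod N (isT : (0 < 3)%N).
  move: (N %/ 3)%N (N %% 3)%N n0 => n r n0 lt_r eN; rewrite !inE => hn'.
  have [n1 n22] : (1 < n)%N /\ (n <= 22)%N.
    by split; case/or4P: hn' => /eqP en; move: n0; rewrite en.
  by split=> //; apply: harmonic3_sub1_ndvd; lia.
right; have p4 : (3 < p)%N.
  by have := prime_gt1 pp; case: p pp p2 p3 {le_pN h p0 hN hn n0} => [|[|[|[|]]]].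
split=> //; rewrite ltnNge; apply/negP => n3.
have c d : (0 < d < 4)%N -> coprime p d.
  by move=> /andP[d0 d4]; rewrite prime_coprime // gtnNdvd // (leq_trans d4).
have hnf a d (e : harmonic (N %/ p) = a%:R / d%:R) : coprime p d -> (p %| a)%N.
  by move=> cd; apply: (frac_dvd_prime cd p0); rewrite -e.
have : (N %/ p = 1 \/ N %/ p = 2 \/ N %/ p = 3)%N by lia.
case=> [e|[e|e]].
- have := @hnf 1%N 1%N; rewrite e /harmonic big_nat1 invr1 divr1 coprimen1.
  by move=> /(_ erefl isT); rewrite dvdn1 gtn_eqF ?prime_gt1.
- have := @hnf 3%N 2%N; rewrite e /harmonic unlock /= => /(_ erefl (c 2%N isT)).
  by rewrite gtnNdvd.
have := @hnf 11%N 6%N; rewrite e /harmonic unlock /= => /(_ erefl).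
rewrite (@coprimeMr p 2 3) !c // => /(_ isT).
rewrite dvdn_prime2 // => /eqP e11; move: h; rewrite e11; apply/negP.
apply: harmonic11_sub1_ndvd; rewrite e11 in e.
by have := divn_eq N 11; rewrite e; have := ltn_pmod N (isT : (0 < 11)%N); lia.
Qed.

(** * The coefficient congruence *)

Lemma F_seriesE N k m : F_series N k m = multinom N m ^+ k.
Proof. by rewrite /F_series /multinom !natrX expr_div_n [(k * N)%N]mulnC exprM. Qed.

Section CoefDivisibility.

Variables (p N k : nat) (xi : int).
Hypotheses (pp : prime p) (k0 : (0 < k)%N).
Hypothesis xi_le : xi <= (N %/ p).-1%:Z.
Hypothesis hxi : (harmonic N - 1) / p%:R ^ xi \in pint p.
Hypothesis hW : forall j,
  (p%:R * harmonic_gap N (p * j) - harmonic_gap N j) / p%:R ^ (xi + 1) \in pint p.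

Let B := F_series N k.
Let p0 : (0 < p)%N. Proof. exact: prime_gt0. Qed.
Let pu : p%:R != 0 :> rat. Proof. by rewrite pnatr_eq0 -lt0n. Qed.
Let pxi : p%:R ^ xi != 0 :> rat. Proof. by rewrite expfz_neq0. Qed.
Let pxi1 : p%:R ^ (xi + 1) = p%:R ^ xi * p%:R :> rat.
Proof. by rewrite expfzDr // expr1z. Qed.

Let C : rat := N`!%:R ^+ k.
Let C0 : C != 0. Proof. by rewrite expf_neq0 // pnatr_eq0 -lt0n fact_gt0. Qed.

Let B_neq0 m : B m != 0.
Proof. by rewrite /B F_seriesE expf_neq0 // multinom_neq0. Qed.

Let B00 : B 0%N = 1.
Proof. by rewrite /B F_seriesE /multinom muln0 fact0 expr1n divr1 expr1n. Qed.

Let BE M v : B (p * M + v)%N / B M = multinom_ratio p N v M ^+ k.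
Proof. by rewrite /B !F_seriesE -expr_div_n. Qed.

Let B_ratio v M : (v < p)%N -> B (p * M + v)%N / B M \in pint p.
Proof. by move=> lt_vp; rewrite BE rpredX // multinom_ratio_pint. Qed.

Let B_cong v M m s : (v < p)%N ->
  (B (p * (m * p ^ s + M) + v)%N / B (m * p ^ s + M)%N - B (p * M + v)%N / B M)
    / p%:R ^+ s.+1 \in pint p.
Proof.
move=> lt_vp; rewrite !BE; apply: pint_congX; rewrite ?multinom_ratio_pint //.
exact: multinom_ratio_cong.
Qed.

Let B_dvd m : (0 < m)%N -> B m / C \in pint p.
Proof.
by move=> m0; rewrite /B /C F_seriesE -expr_div_n rpredX // multinom_dvd_fact.
Qed.

Let B_pint m : B m \in pint p.
Proof.
have [->|m0] := posnP m; first by rewrite B00 rpred1.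
have := rpredM (B_dvd m0) (rpredX k (rpred_nat (pint p) N`!)).
by rewrite divfK.
Qed.

(** Of the k factors of [B], k - 1 absorb one N! each and the last carries the harmonic
    difference. *)
Let B_harmonic_gap M v : (0 < v < p)%N ->
  B (p * M + v)%N * (harmonic_gap N (p * M + v) - harmonic_gap N (p * M))
    / (p%:R ^ xi * C) \in pint p.
Proof.
move=> hv; have m0 : (0 < p * M + v)%N by lia.
have := rpredM (rpredX k.-1 (multinom_dvd_fact pp N m0))
  (multinom_harmonic_pint pp xi_le hxi M hv).
apply: eq_pint; set x := multinom _ _ / _.
have ex : B (p * M + v)%N = x ^+ k.-1 * x * C.
  by rewrite -exprSr prednK // -exprMn /x divfK ?pnatr_eq0 -?lt0n ?fact_gt0 //
    -F_seriesE.
by rewrite ex; field; rewrite pxi C0.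
Qed.

Let harmonic_gap0 : harmonic_gap N 0 = 0.
Proof. by rewrite /harmonic_gap muln0 subrr. Qed.

Let harmonic_gap_scale s m :
  (p%:R ^+ s * harmonic_gap N (m * p ^ s) - harmonic_gap N m)
    / p%:R ^ (xi + 1) \in pint p.
Proof.
elim: s => [|s IH]; first by rewrite mul1r muln1 subrr mul0r rpred0.
have := rpredD IH (rpredM (rpredX s (rpred_nat (pint p) p)) (hW (m * p ^ s))).
apply: eq_pint; have -> : (m * p ^ s.+1 = p * (m * p ^ s))%N by rewrite expnS; ring.
by rewrite exprS; ring.
Qed.

(** Provides the hypothesis of [dwork_weighted]: [harmonic_gap_scale] removes the common factor p^s
    of the arguments, and [B_harmonic_gap] treats the remaining difference. *)
Let weight s u v : (v < p)%N ->
  (harmonic_gap N ((u * p + v) * p ^ s) - harmonic_gap N (u * p ^ s.+1)) *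
    (p%:R ^+ s.+1 * B (u * p + v)%N) / (p%:R ^ (xi + 1) * C) \in pint p.
Proof.
move=> lt_vp; have -> : (u * p ^ s.+1 = (u * p) * p ^ s)%N by rewrite expnS mulnA.
have [->|v0] := posnP v; first by rewrite addn0 subrr !mul0r rpred0.
have m0 : (0 < u * p + v)%N by lia.
have hs := rpredB (harmonic_gap_scale s (u * p + v)) (harmonic_gap_scale s (u * p)).
have h1 := rpredM (rpred_nat (pint p) p) (rpredM hs (B_dvd m0)).
have hv : (0 < v < p)%N by rewrite v0.
have := rpredD h1 (B_harmonic_gap u hv); rewrite [(p * u)%N]mulnC.
by apply: eq_pint; rewrite pxi1 exprS; field; rewrite pxi C0 pu.
Qed.

(** Adding and subtracting H~(j) B(pj+a) B(K-j) splits the sum: one part is H~(j) times Dwork's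
    antisymmetric term, settled by [dwork_weighted]; the other is divisible term by term. *)
Lemma coef_congruence K a : (a < p)%N ->
  (\sum_(j < K.+1) (harmonic_gap N j - p%:R * harmonic_gap N (p * (K - j) + a)) *
     (B (p * (K - j) + a)%N * B j)) / (p%:R ^ (xi + 1) * C) \in pint p.
Proof.
move=> lt_ap.
have c0 : p%:R ^ (xi + 1) * C != 0 by rewrite mulf_neq0 // expfz_neq0.
have h1 := dwork_weighted pp B_neq0 B00 B_ratio B_cong lt_ap K c0 weight.
suff h2 : (\sum_(j < K.+1) (harmonic_gap N j - p%:R * harmonic_gap N (p * j + a)) *
     (B (p * j + a)%N * B (K - j)%N)) / (p%:R ^ (xi + 1) * C) \in pint p.
  have := rpredD h1 h2; apply: eq_pint; rewrite -mulrDl; congr (_ / _).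
  pose u j := harmonic_gap N j * (B (p * (K - j) + a)%N * B j).
  pose v j := harmonic_gap N j * (B (p * j + a)%N * B (K - j)%N).
  pose w j := p%:R * harmonic_gap N (p * j + a) * (B (p * j + a)%N * B (K - j)%N).
  rewrite (eq_bigr (fun j : 'I_K.+1 => u j - v j)); last first.
    move=> j _; have le_jK : (j <= K)%N by rewrite -ltnS.
    by rewrite /u /v /dwork_term le_jK; ring.
  rewrite [X in _ + X](eq_bigr (fun j : 'I_K.+1 => v j - w j)); last first.
    by move=> j _; rewrite /v /w; ring.
  rewrite [RHS](eq_bigr (fun j : 'I_K.+1 => u j - w (K - j)%N)); last first.
    move=> j _; have le_jK : (j <= K)%N by rewrite -ltnS.
    by rewrite /u /w subKn //; ring.
  rewrite !sumrB [\sum_(j < _) w (K - j)%N](reindex_inj rev_ord_inj) /=.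
  have -> : \sum_(j < K.+1) w (K - (K.+1 - j.+1))%N = \sum_(j < K.+1) w j.
    apply: eq_bigr => j _; have le_jK : (j <= K)%N by rewrite -ltnS.
    by rewrite subSS subKn.
  ring.
rewrite mulr_suml; apply: rpred_sum => j _.
(* The difference H~(j) - p H~(pj+a) passes through p H~(pj): [hW] covers the first step,
   [B_harmonic_gap] the second. *)
have -> : (harmonic_gap N j - p%:R * harmonic_gap N (p * j + a)) * (B (p * j
  + a)%N * B (K - j)%N)
   / (p%:R ^ (xi + 1) * C) =
  - B (K - j)%N * ((p%:R * harmonic_gap N (p * j) - harmonic_gap N j)
    / p%:R ^ (xi + 1) * (B (p * j + a)%N / C)
   + B (p * j + a)%N * (harmonic_gap N (p * j + a) - harmonic_gap N (p * j))
     / (p%:R ^ xi * C)).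
  by rewrite pxi1; field; rewrite pxi C0 pu.
have [m0|m0] := posnP (p * j + a).
  have [/eqP j0 a0] : (nat_of_ord j == 0)%N /\ a = 0%N by split; lia.
  by rewrite j0 a0 addn0 muln0 harmonic_gap0 !(subrr, mulr0, mul0r, addr0) rpred0.
apply: rpredM; first by rewrite rpredN.
apply: rpredD; first exact: rpredM (hW j) (B_dvd m0).
have [->|a0] := posnP a; first by rewrite addn0 subrr mulr0 mul0r rpred0.
by apply: B_harmonic_gap; rewrite a0.
Qed.

Lemma coef_mul_compXn (P Q : {poly rat}) m :
  (P * (Q \Po 'X^p))`_m = \sum_(j < (m %/ p).+1) P`_(m - p * j) * Q`_j.
Proof.
rewrite coefMr.
pose f i := P`_(m - i) * (Q \Po 'X^p)`_i.
rewrite -(big_mkord xpredT f).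
have lt_m : (m < (m %/ p).+1 * p)%N by rewrite -ltn_divLR.
have -> : \sum_(0 <= i < m.+1) f i = \sum_(0 <= i < (m %/ p).+1 * p) f i.
  rewrite [RHS](big_cat_nat (n := m.+1)) //= [X in _ + X]big_nat_cond.
  rewrite [X in _ + X]big1 ?addr0 // => i /andP[/andP[lt_mi lt_i] _].
  rewrite /f coef_comp_poly_Xn //; case: ifP => [/dvdnP[q eq]|];
    last by rewrite mulr0.
  move: lt_i; rewrite eq ltn_mul2r p0 ltnS /= leq_divRL // -eq.
  by rewrite leqNgt lt_mi.
rewrite big_mkord sum_mulnr; apply: eq_bigr => u _.
rewrite -(big_mkord xpredT (fun v =>
  f (u * p + v)%N)) -{1}(prednK p0) big_nat_recl //.
rewrite big_nat_cond big1 => [|v /andP[/andP[_ lt_v] _]].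
  by rewrite addr0 addn0 /f coef_comp_poly_Xn // dvdn_mull // mulnK // mulnC.
rewrite /f coef_comp_poly_Xn // dvdn_addr ?dvdn_mull // gtnNdvd ?mulr0 //.
lia.
Qed.

Variables (omega_N : rat) (g : ps).
Hypothesis omega0 : omega_N != 0.
Hypothesis homega : p%:R ^ xi / omega_N \in pint p.
Hypothesis gF : ps_mul g B =1 (fun m => harmonic_gap N m * B m / (omega_N * C)).

(** Multiplied by F(z) F(z^p), the defect g(z^p) - p g(z) becomes F(z) (gF)(z^p) - p F(z^p) (gF)(z).
    The multiplier has integral coefficients and constant term 1, so it can be divided out again. *)
Lemma frobenius_defect n :
  ((if (p %| n)%N then g (n %/ p)%N else 0) - p%:R * g n) / p%:R \in pint p.
Proof.
pose W m := harmonic_gap N m * B m / (omega_N * C).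
pose P (h : ps) : {poly rat} := \poly_(i < n.+1) h i.
have Pc h m : (m <= n)%N -> (P h)`_m = h m by rewrite coef_poly ltnS => ->.
have GF : eq_below n.+1 (P g * P B) (P W).
  move=> m le_m; rewrite (Pc W) // -[W m]gF coefM; apply: eq_bigr => i _.
  by have := ltn_ord i => ?; rewrite !Pc //; lia.
have GFX : eq_below n.+1 ((P g * P B) \Po 'X^p) (P W \Po 'X^p).
  move=> m le_m; rewrite !coef_comp_poly_Xn //; case: ifP => // _; apply: GF.
  exact: leq_ltn_trans (leq_div _ _) le_m.
pose D : {poly rat} := (P g \Po 'X^p) - p%:R *: P g.
pose E : {poly rat} := P B * (P B \Po 'X^p).
have hB : P B \is a polyOver (pint p).
  apply/polyOverP => i; rewrite coef_poly; case: ifP => _ //; exact: rpred0.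
have hE : E \is a polyOver (pint p).
  rewrite rpredM //; apply/polyOverP => i; rewrite coef_comp_poly_Xn //.
  by case: ifP => _; [apply/polyOverP | apply: rpred0].
have E0 : E`_0 = 1.
  by rewrite coef0M coef_comp_poly_Xn // dvdn0 div0n !Pc // B00 mulr1.
have DE m : (m <= n)%N -> (D * E)`_m / p%:R \in pint p.
  move=> le_m.
  have -> : D * E = P B * ((P g * P B) \Po 'X^p) - p%:R *: ((P g * P B)
    * (P B \Po 'X^p)).
    by rewrite /D /E comp_polyM mulrBl -scalerAl -!mul_polyC; ring.
  rewrite coefB coefZ (eq_belowM (fun _ _ =>
    erefl) GFX) // (eq_belowM GF (fun _ _ => erefl)) //.
  rewrite !coef_mul_compXn.
  have lt_a : (m %% p < p)%N by rewrite ltn_pmod.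
  (* The coefficient of index m is the sum for K = [m/p] and a = m mod p. *)
  have := rpredM (coef_congruence (m %/ p) lt_a) homega.
  rewrite mulr_sumr -sumrB; apply: eq_pint.
  rewrite pxi1.
  have -> : forall x : rat, x / (p%:R ^ xi * p%:R * C) * (p%:R ^ xi / omega_N) =
     x / (omega_N * C) / p%:R by move=> x; field; rewrite pxi pu C0 omega0.
  congr (_ / _); rewrite mulr_suml; apply: eq_bigr => j _.
  have le_j : (p * j <= m)%N.
    by rewrite mulnC -leq_divRL // -ltnS.
  have -> : (p * (m %/ p - j) + m %% p = m - p * j)%N.
    have lj : (p * j <= p * (m %/ p))%N by rewrite leq_mul2l -ltnS ltn_ord orbT.
    by rewrite mulnBr addnBAC // [(p * (m %/ p))%N]mulnC -divn_eq.
  have le_jn : (j <= n)%N by apply: leq_trans le_m; apply: leq_trans le_j;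
    rewrite leq_pmull.
  rewrite !Pc ?(leq_trans (leq_subr _ _)) // /W; ring.
have hD m : (m <= n)%N -> D`_m / p%:R \in pint p.
  elim/ltn_ind: m => m IH le_m; have := DE m le_m.
  rewrite coefM big_ord_recr /= subnn E0 mulr1 mulrDl.
  set S := _ / _; have hS : S \in pint p.
    rewrite /S mulr_suml; apply: rpred_sum => i _; rewrite mulrAC rpredM //.
      by apply: IH => //; apply: leq_trans (ltnW (ltn_ord i)) le_m.
    exact/polyOverP.
  by move/rpredB => /(_ _ hS); rewrite addrC addKr.
have := hD n (leqnn n); rewrite /D coefB coefZ Pc //.
rewrite coef_comp_poly_Xn //; apply: eq_pint; case: ifP => // _.
by rewrite Pc // leq_div.
Qed.

End CoefDivisibility.

(** * The exponents in Omega *)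

Definition Omega_exp (p N : nat) : int :=
  if (p <= N)%N then Num.min (2 + omega p N)%N%:Z (vp p (harmonic N - 1)) else 0.

Lemma Omega_neq0 N : Omega N != 0.
Proof.
apply/prodf_neq0 => q /prime_gt0 q0.
by rewrite expfz_neq0 // pnatr_eq0 -lt0n.
Qed.

Lemma Omega_exp_ratio p N : prime p -> p%:R ^ Omega_exp p N / Omega N \in pint p.
Proof.
move=> pp; have pu : p%:R != 0 :> rat by rewrite pnatr_eq0 -lt0n prime_gt0.
have factor q (e : int) : prime q -> q != p -> (q%:R ^ e)^-1 \in pint p.
  move=> pq ne; rewrite invr_expz; apply: pint_exprz.
  by rewrite prime_coprime // dvdn_prime2 // eq_sym.
rewrite /Omega_exp /Omega; case: leqP => [le_pN|lt_Np].
  have lt_pN : (p < N.+1)%N by [].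
  rewrite (bigD1 (Ordinal lt_pN)) //= invfM mulrA divff ?expfz_neq0 // mul1r.
  rewrite -prodfV; apply: rpred_prod => q /andP[pq ne].
  by apply: factor.
rewrite expr0z mul1r -prodfV; apply: rpred_prod => q pq.
by apply: factor => //; have := ltn_ord q; case: eqP => // ->; lia.
Qed.

Lemma pint_exp_le p (x : rat) (a b : int) : prime p -> a <= b ->
  x / p%:R ^ b \in pint p -> x / p%:R ^ a \in pint p.
Proof.
move=> pp le_ab h; have pu : p%:R != 0 :> rat by rewrite pnatr_eq0 -lt0n prime_gt0.
apply: eq_pint (rpredM h (rpredX `|b - a|%N (rpred_nat (pint p) p))).
rewrite exprnP gez0_abs ?subr_ge0 // expfzDr // -invr_expz.
by field; rewrite !expfz_neq0.
Qed.

Lemma harmonic_block0E p : harmonic_block p 0 = harmonic p.-1.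
Proof.
rewrite /harmonic big_add1 big_mkord; apply: eq_bigr => l _.
by rewrite muln0.
Qed.

Lemma harmonic_gap_mulp p N j : prime p ->
  p%:R * harmonic_gap N (p * j) - harmonic_gap N j =
  p%:R * (\sum_(i < N * j) harmonic_block p i - \sum_(i < j) harmonic_block p i).
Proof.
move=> pp; have pu : p%:R != 0 :> rat by rewrite pnatr_eq0 -lt0n prime_gt0.
have h M := harmonic_mulp pp M.
rewrite /harmonic_gap; have -> : (N * (p * j) = p * (N * j))%N by ring.
by rewrite /harmonic_block -!h; field.
Qed.

Lemma harmonic_block_diff_mod p N j : prime p -> odd p ->
  (\sum_(i < N * j) harmonic_block p i - \sum_(i < j) harmonic_block p i
   - (j ^ 2)%:R * (N%:R - 1) * (N%:R + 1) * harmonic_block p 0)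
     / p%:R ^+ 3 \in pint p.
Proof.
move=> pp p_odd; have := rpredB (sum_harmonic_block_cong pp p_odd (N
  * j)) (sum_harmonic_block_cong pp p_odd j).
by apply: eq_pint; rewrite !natrX natrM; ring.
Qed.

(** Either p^3 divides H_(p-1) because p is a Wolstenholme prime, or Wolstenholme's theorem gives
    p^2 and one of N - 1, N + 1 the third p. *)
Lemma omega1_dvd p N : prime p -> (3 < p)%N -> omega p N = 1%N ->
  (N%:R - 1) * (N%:R + 1) * harmonic_block p 0 / p%:R ^+ 3 \in pint p.
Proof.
move=> pp p3; have pu : p%:R != 0 :> rat by rewrite pnatr_eq0 -lt0n prime_gt0.
have p_odd : odd p by case/even_prime: (pp) p3 => [->|].
have dvd (m : int) : (p%:Z %| m)%Z -> m%:~R / p%:R \in pint p.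
  move=> /dvdzP[q ->]; apply: pint_int.
  by rewrite intrM mulfK // intr_int.
have N_int : N%:R \in pint p by exact: rpred_nat.
rewrite /omega; case: ifP => // /or3P[/andP[_ hw]|h1|h1] _.
- have := vp_pint pp hw; rewrite -exprnP -harmonic_block0E => h.
  by rewrite -mulrA rpredM // rpredM ?rpredB ?rpredD ?rpred1.
- rewrite eqz_mod_dvd in h1; have h2 := harmonic_block0_dvd2 pp p_odd p3.
  have := rpredM (rpredM (dvd _ h1) (rpredD N_int (rpred1 _))) h2.
  apply: eq_pint; rewrite rmorphB /= -pmulrn;
    move: (harmonic_block _ _) (N%:R : rat) => h n.
  by field.
- rewrite eqz_mod_dvd in h1; have h2 := harmonic_block0_dvd2 pp p_odd p3.
  have := rpredM (rpredM (dvd _ h1) (rpredB N_int (rpred1 _))) h2.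
  apply: eq_pint; rewrite rmorphB rmorphN /= opprK -pmulrn.
  move: (harmonic_block _ _) (N%:R : rat) => h n.
  by field.
Qed.

Section Exponent.

Variables (p N : nat).
Hypotheses (pp : prime p).
Let xi := Omega_exp p N.
Let pu : p%:R != 0 :> rat. Proof. by rewrite pnatr_eq0 -lt0n prime_gt0. Qed.

Lemma Omega_exp_harmonic : (harmonic N - 1) / p%:R ^ xi \in pint p.
Proof.
rewrite /xi /Omega_exp; case: leqP => [_|lt_Np].
  by apply: vp_pint => //; rewrite ge_min lexx orbT.
rewrite expr0z divr1 rpredB ?rpred1 //.
have := harmonic_ltp pp 0 lt_Np; rewrite muln0 add0n.
by rewrite [harmonic 0]big_nil mul0r subr0.
Qed.

Lemma Omega_exp_pos : 0 < xi ->
  [/\ p = 3%N, xi <= 1 & (1 < N %/ p)%N]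
  \/ [/\ (3 < p)%N, xi <= (2 + omega p N)%N%:Z & (3 < N %/ p)%N].
Proof.
move=> xi0; have le_pN : (p <= N)%N.
  by move: xi0; rewrite /xi /Omega_exp; case: leqP => //; rewrite ltxx.
have h1 : (harmonic N - 1) / p%:R \in pint p.
  by have := @pint_exp_le p _ 1 xi pp xi0 Omega_exp_harmonic; rewrite expr1z.
case: (harmonic_sub1_dvd pp le_pN h1) => [[p3 n1 h9]|[p3 n3]]; [left|right].
  split=> //; rewrite leNgt; apply/negP => xi2.
  have := @pint_exp_le p _ 2 xi pp xi2 Omega_exp_harmonic.
  by rewrite -exprnP p3 -natrX (negPf h9).
by split=> //; rewrite /xi /Omega_exp le_pN ge_min lexx.
Qed.

Lemma Omega_exp_floor : xi <= (N %/ p).-1%:Z.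
Proof.
have [xi0|] := leP xi 0; first exact: le_trans xi0 _.
case/Omega_exp_pos => [[_ h n1]|[_ h n3]]; apply: le_trans h _; rewrite lez_nat.
  by lia.
by rewrite /omega; case: ifP; lia.
Qed.

(** The factor p in front accounts for the +1. The rest is j^2 (N^2 - 1) s_0 mod p^3, where s_0 is
    divisible by p for p = 3 and by p^2 for p > 3; [omega1_dvd] gives the third power when [omega]
    is 1. *)
Lemma Omega_exp_gap j : (p%:R * harmonic_gap N (p * j) - harmonic_gap N j)
  / p%:R ^ (xi + 1) \in pint p.
Proof.
rewrite harmonic_gap_mulp //; set T := _ - _.
suff h : T / p%:R ^ xi \in pint p.
  by rewrite expfzDr // expr1z [_ ^ xi * _]mulrC invfM mulrACA divff // mul1r.
have [xi0|xi0] := leP xi 0.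
  apply: (@pint_exp_le p _ xi 0) => //; rewrite expr0z divr1.
  have hb n : \sum_(i < n) harmonic_block p i \in pint p.
    by apply: rpred_sum => i _; exact: harmonic_block_pint.
  exact: rpredB.
have main (e : nat) : odd p -> xi <= e%:Z -> (e <= 3)%N ->
    (j ^ 2)%:R * (N%:R - 1) * (N%:R + 1) * harmonic_block p 0
      / p%:R ^+ e \in pint p ->
    T / p%:R ^ xi \in pint p.
  move=> p_odd le_xi le_e h; apply: (@pint_exp_le p _ xi e) => //.
  have e3 : e%:Z <= 3%:Z by rewrite lez_nat.
  have := rpredD h (pint_exp_le pp e3 (harmonic_block_diff_mod N j pp p_odd)).
  by rewrite exprnP -mulrDl addrC subrK.
have cst : (j ^ 2)%:R * (N%:R - 1) * (N%:R + 1) \in pint p.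
  by rewrite !rpredM ?rpredB ?rpredD ?rpred1 ?rpred_nat.
case: (Omega_exp_pos xi0) => [[p3 xi1 _]|[p3 le_xi _]].
  have p_odd : odd p by rewrite p3.
  by apply: (main 1%N) => //; rewrite -mulrA rpredM // harmonic_block0_dvd.
have p_odd : odd p by case/even_prime: (pp) p3 => [->|].
move: le_xi (@omega1_dvd p N pp p3); rewrite {1}/omega.
case: ifP => w le_xi h1.
  apply: (main 3%N) => //; have /h1 : omega p N = 1%N by rewrite /omega w.
  by move/(rpredM (rpred_nat (pint p) (j ^ 2))); rewrite !mulrA.
by apply: (main 2%N) => //; rewrite -mulrA rpredM // harmonic_block0_dvd2.
Qed.

End Exponent.

(** * Integrality of the root, prime by prime *)

Unset Implicit Arguments.

Theorem theorem2 (N k : nat) (hN : (2 <= N)%N) (hk : (1 <= k)%N) :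
  exists2 b : ps,
    ps_is_rpow (ps_divz (q_map N k))
      (1 / (Omega N * (N`! ^ k)%N%:R * k%:R * N%:R)) b
    & ps_integral b.
Proof.
set alpha := 1 / _; pose Q := ps_div (G_series N k) (F_series N k).
have F0 : F_series N k 0%N = 1.
  by rewrite F_seriesE /multinom muln0 fact0 expr1n divr1 expr1n.
have QF : ps_mul Q (F_series N k) =1 G_series N k.
  by apply: ps_divK; rewrite F0 oner_eq0.
have Q0 : Q 0%N = 0.
  have := QF 0%N; rewrite /ps_mul big_ord1 F0 mulr1 => ->.
  by rewrite /G_series muln0 subrr mulr0 mul0r.
exists (ps_exp (ps_scale alpha Q)); first by exists Q.
move=> n; apply: int_pint => p pp.
apply: dieudonne_dwork => // [|m]; first by rewrite /ps_scale Q0 mulr0.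
apply: (frobenius_defect pp hk (Omega_exp_floor N pp) (Omega_exp_harmonic N pp)
  (Omega_exp_gap N pp) (Omega_neq0 N) (Omega_exp_ratio N pp)) => i.
have -> : ps_mul (ps_scale alpha Q) (F_series N k) i = alpha * G_series N k i.
  rewrite -QF /ps_mul mulr_sumr; apply: eq_bigr => j _.
  by rewrite /ps_scale -mulrA.
have Nu : N%:R != 0 :> rat by rewrite pnatr_eq0 -lt0n ltnW.
have ku : k%:R != 0 :> rat by rewrite pnatr_eq0 -lt0n.
have fu : N`!%:R ^+ k != 0 :> rat by rewrite expf_neq0 // pnatr_eq0 -lt0n fact_gt0.
have Ou := Omega_neq0 N.
(* The factor k N of [G_series] cancels that of [alpha], which leaves the normalisation required by
   [frobenius_defect]. *)
rewrite /alpha /G_series -/(harmonic_gap N i) natrX natrM.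
move: (F_series _ _ _) (harmonic_gap _ _) (Omega _) (N`!%:R ^+ k : rat) Ou fu =>
  F H O C Ou fu.
by field; rewrite Nu ku fu Ou.
Qed.
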